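(* Let $K$ be a field, $n\ge1$, and let $A_n$ be the quiver $1\to2\to3\to\cdots\to n$. There exists a bijection between the set of torsion pairs on $KA_n\text{-mod}$ and the set of complete strong 1-type part partitions of $A_n$.
   Context: $KA_n\text{-mod}$ is the category of finite-dimensional left $KA_n$-modules. A torsion pair on it is a pair $(\mathcal{T},\mathcal{F})$ of full (isomorphism-closed) subcategories with $\mathrm{Hom}(X,Y)=0$ for $X\in\mathcal{T},Y\in\mathcal{F}$ and such that every module $X$ has an exact sequence $0\to X_{\mathcal{T}}\to X\to X_{\mathcal{F}}\to0$ with $X_{\mathcal T}\in\mathcal T,X_{\mathcal F}\in\mathcal F$. For a quiver $Q$ with vertex set $Q_0$ and $\Omega\subseteq Q_0$, $Q(\Omega)$ denotes the full subquiver with vertex set $\Omega$. Let $\{\Delta_0,\Delta_1,\dots,\Delta_m\}$ ($m\geq0$) be a tuple (ordered sequence) of pairwise disjoint subsets of $Q_0$ with $\Delta_1,\dots,\Delta_m$ nonempty ($\Delta_0$ may be empty). It is a strong 1-type part partition of $Q$ if for all $i>0$ (with the indices in question at most $m$): $\Delta_{2i-1}$ contains all sinks of $Q(Q_0-\Delta_0-\Delta_1-\dots-\Delta_{2i-2})$, and $\Delta_{2i}$ contains all sources of $Q(Q_0-\Delta_0-\Delta_1-\dots-\Delta_{2i-1})$. It is complete if $\Delta_0\cup\Delta_1\cup\dots\cup\Delta_m=Q_0$. *)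

(* Defs.v *)
From HB Require Import structures.
From mathcomp Require Import all_boot all_algebra.
From mathcomp Require Import finmap.
From mathcomp Require Import monalg.

Set Implicit Arguments.
Unset Strict Implicit.
Unset Printing Implicit Defensive.

Import GRing.Theory.
Local Open Scope ring_scope.

Record quiver := Quiver {
  vertex : finType;
  arrow : finType;
  source : arrow -> vertex;
  target : arrow -> vertex
}.

Section Paths.
Variable Q : quiver.

Fixpoint walk (x : vertex Q) (s : seq (arrow Q)) : bool :=
  if s is a :: s' then (source a == x) && walk (target a) s' else true.

Definition walk_end (x : vertex Q) (s : seq (arrow Q)) : vertex Q :=
  last x (map (@target Q) s).

(* The starting vertex is recorded so that every vertex has a trivial path. *)
Record qpath : predArgType := QPath {
  qpath_val : vertex Q * seq (arrow Q);
  _ : walk qpath_val.1 qpath_val.2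
}.

HB.instance Definition _ := [isSub for qpath_val].
HB.instance Definition _ := [Choice of qpath by <:].

Definition psource (p : qpath) : vertex Q := (qpath_val p).1.
Definition parrows (p : qpath) : seq (arrow Q) := (qpath_val p).2.
Definition ptarget (p : qpath) : vertex Q := walk_end (psource p) (parrows p).

Definition ptriv (x : vertex Q) : qpath := @QPath (x, [::]) isT.

(* Paths compose like functions: [pcomp p q] is "first q, then p", so that
   left modules over the path algebra are covariant representations of Q. *)
Definition pcomp (p q : qpath) : option qpath :=
  if psource p == ptarget q then insub (psource q, parrows q ++ parrows p)
  else None.

Lemma walk_cat x s t : walk x (s ++ t) = walk x s && walk (walk_end x s) t.
Proof. by elim: s x => //= a s IH x; rewrite IH andbA. Qed.

Lemma walk_end_cat x s t :
  walk_end x (s ++ t) = walk_end (walk_end x s) t.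
Proof. by rewrite /walk_end map_cat last_cat. Qed.

Lemma qpath_walk (p : qpath) : walk (psource p) (parrows p).
Proof. by case: p. Qed.

Lemma qpathP (p q : qpath) :
  psource p = psource q -> parrows p = parrows q -> p = q.
Proof.
case: p q => -[x s] p [[y t] q]; rewrite /psource /parrows /= => e1 e2.
by apply: val_inj => /=; rewrite e1 e2.
Qed.

Variant pcomp_spec (p q : qpath) : option qpath -> bool -> Prop :=
| PcompSome r of psource r = psource q & parrows r = parrows q ++ parrows p
    & ptarget r = ptarget p : pcomp_spec p q (Some r) true
| PcompNone : pcomp_spec p q None false.

Lemma pcompP p q : pcomp_spec p q (pcomp p q) (psource p == ptarget q).
Proof.
rewrite /pcomp; case: eqP => [e|_]; last by constructor.
have w : walk (psource q) (parrows q ++ parrows p).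
  by rewrite walk_cat qpath_walk -[walk_end _ _]/(ptarget q) -e qpath_walk.
case: insubP => [r _ er|]; last by rewrite w.
have [sr ar] : psource r = psource q /\ parrows r = parrows q ++ parrows p.
  by rewrite /psource /parrows [qpath_val r]er.
apply: PcompSome => //; rewrite /ptarget sr ar walk_end_cat.
by rewrite -[walk_end (psource q) _]/(ptarget q) -e.
Qed.

Lemma pcompE p q r : psource r = psource q ->
  parrows r = parrows q ++ parrows p -> psource p = ptarget q ->
  pcomp p q = Some r.
Proof.
move=> e1 e2 e3; have := pcompP p q; rewrite e3 eqxx => h.
by inversion h as [u su au _ eu|]; congr Some; apply: qpathP; congruence.
Qed.

Lemma pcompN p q : psource p != ptarget q -> pcomp p q = None.
Proof. by rewrite /pcomp => /negbTE ->. Qed.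

Lemma pcompA p q r :
  obind (pcomp p) (pcomp q r) = obind (pcomp^~ r) (pcomp p q).
Proof.
case: (psource q =P ptarget r) => [e|/eqP e]; last first.
  rewrite (pcompN e) /=; case: pcompP => //= v sv _ _.
  by rewrite pcompN // sv.
case: (psource p =P ptarget q) => [f|/eqP f]; last first.
  rewrite (pcompN f) /=; case: pcompP => //= v _ _ tv.
  by rewrite pcompN // tv.
move: (pcompP p q) (pcompP q r); rewrite e f !eqxx => hv hu.
inversion hv as [v sv av tv ev|]; inversion hu as [u su au tu eu|] => /=.
move: (pcompP p u); rewrite tu f eqxx => hw.
inversion hw as [w sw aw tw ew|]; apply/esym/pcompE; last by rewrite sv.
  by rewrite sw.
by rewrite aw av au catA.
Qed.

Lemma pcomp1p p x : pcomp (ptriv x) p = if x == ptarget p then Some p else None.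
Proof.
case: eqP => [e|/eqP e]; last exact: pcompN.
by apply: pcompE => //; rewrite cats0.
Qed.

Lemma pcompp1 p x : pcomp p (ptriv x) = if x == psource p then Some p else None.
Proof.
rewrite eq_sym; case: eqP => [e|/eqP e]; last exact: pcompN.
exact: pcompE.
Qed.

End Paths.

Arguments ptriv {Q} x.

Section Span.
Variables (K : fieldType) (V : lmodType K) (I : Type) (U : I -> V).
Variable m : V -> V -> V.
Hypotheses (mDl : left_distributive m +%R) (mDr : right_distributive m +%R).
Hypothesis spanU : forall P : V -> Prop, P 0 ->
  (forall f g, P f -> P g -> P (f + g)) -> (forall i, P (U i)) -> forall f, P f.

Lemma span_mul0l : left_zero 0 m.
Proof. by move=> f; apply: (addIr (m 0 f)); rewrite -mDl !add0r. Qed.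

Lemma span_mul0r : right_zero 0 m.
Proof. by move=> f; apply: (addIr (m f 0)); rewrite -mDr !add0r. Qed.

Lemma span_mulA : (forall i j k, m (U i) (m (U j) (U k)) =
  m (m (U i) (U j)) (U k)) -> associative m.
Proof.
move=> H f g h; elim/spanU: f => [|f1 f2 e1 e2|i].
- by rewrite !span_mul0l.
- by rewrite !mDl e1 e2.
elim/spanU: g => [|g1 g2 e1 e2|j].
- by rewrite !(span_mul0l, span_mul0r).
- by rewrite !(mDl, mDr) e1 e2.
elim/spanU: h => [|h1 h2 e1 e2|k]; last exact: H.
- by rewrite !span_mul0r.
- by rewrite !mDr e1 e2.
Qed.

Lemma span_scaleAl c : (forall i j, c *: m (U i) (U j) = m (c *: U i) (U j)) ->
  forall f g, c *: m f g = m (c *: f) g.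
Proof.
move=> H f g; elim/spanU: f => [|f1 f2 e1 e2|i].
- by rewrite scaler0 span_mul0l scaler0.
- by rewrite scalerDr !mDl scalerDr e1 e2.
elim/spanU: g => [|g1 g2 e1 e2|j]; last exact: H.
- by rewrite !span_mul0r scaler0.
- by rewrite !mDr scalerDr e1 e2.
Qed.

Lemma span_scaleAr c : (forall i j, c *: m (U i) (U j) = m (U i) (c *: U j)) ->
  forall f g, c *: m f g = m f (c *: g).
Proof.
move=> H f g; elim/spanU: g => [|g1 g2 e1 e2|j].
- by rewrite scaler0 span_mul0r scaler0.
- by rewrite scalerDr !mDr scalerDr e1 e2.
elim/spanU: f => [|f1 f2 e1 e2|i]; last exact: H.
- by rewrite !span_mul0l scaler0.
- by rewrite !mDl scalerDr e1 e2.
Qed.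

Lemma span_mul_suml (J : finType) (F : J -> V) g :
  m (\sum_j F j) g = \sum_j m (F j) g.
Proof. exact: (big_morph (m^~ g) (fun a b => mDl a b g) (span_mul0l g)). Qed.

Lemma span_mul_sumr (J : finType) (F : J -> V) f :
  m f (\sum_j F j) = \sum_j m f (F j).
Proof. exact: (big_morph (m f) (mDr f) (span_mul0r f)). Qed.

Lemma span_mul1l (J : finType) (F : J -> V) (j0 : I -> J) :
  (forall i j, m (F j) (U i) = if j == j0 i then U i else 0) ->
  left_id (\sum_j F j) m.
Proof.
move=> H; elim/spanU => [|f g ef eg|i]; first exact: span_mul0r.
  by rewrite mDr ef eg.
rewrite span_mul_suml (bigD1 (j0 i)) //= H eqxx big1 ?addr0 // => j ne.
by rewrite H (negbTE ne).
Qed.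

Lemma span_mul1r (J : finType) (F : J -> V) (j0 : I -> J) :
  (forall i j, m (U i) (F j) = if j == j0 i then U i else 0) ->
  right_id (\sum_j F j) m.
Proof.
move=> H; elim/spanU => [|f g ef eg|i]; first exact: span_mul0l.
  by rewrite mDl ef eg.
rewrite span_mul_sumr (bigD1 (j0 i)) //= H eqxx big1 ?addr0 // => j ne.
by rewrite H (negbTE ne).
Qed.

End Span.

Definition path_algebra (K : fieldType) (Q : quiver) : Type :=
  {malg K[qpath Q]}.

HB.instance Definition _ (K : fieldType) (Q : quiver) :=
  GRing.Lmodule.on (path_algebra K Q).

(* The scalar multiple c p of a path p. This and [pa_mul] are locked because
   unification is slow on concrete finitely supported functions. *)
HB.lock Definition pa_monom (K : fieldType) (Q : quiver) (c : K)
    (p : qpath Q) : path_algebra K Q := << c *g p >>.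

Definition pa_omonom (K : fieldType) (Q : quiver) (c : K)
    (o : option (qpath Q)) : path_algebra K Q :=
  if o is Some p then pa_monom c p else 0.

HB.lock Definition pa_mul (K : fieldType) (Q : quiver)
    (f g : path_algebra K Q) : path_algebra K Q :=
  \sum_(p <- msupp f) \sum_(q <- msupp g)
    pa_omonom (f@_p * g@_q) (pcomp p q).

Definition pa_one (K : fieldType) (Q : quiver) : path_algebra K Q :=
  \sum_(x : vertex Q) pa_monom 1 (ptriv x).

Section PathAlgebra.
Variables (K : fieldType) (Q : quiver).
Local Notation KQ := (path_algebra K Q).
Local Notation pa_mul := (@pa_mul K Q).
Local Notation pa_one := (pa_one K Q).

Implicit Types (f g h : KQ) (p q r : qpath Q).

Lemma pa_omonom0 o : pa_omonom 0 o = 0 :> KQ.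
Proof. by case: o => //= p; rewrite pa_monom.unlock monalgU0. Qed.

Lemma pa_omonomD o (c d : K) :
  pa_omonom (c + d) o = pa_omonom c o + pa_omonom d o :> KQ.
Proof. by case: o => [p|] /=; rewrite ?pa_monom.unlock ?monalgUD ?addr0. Qed.

Lemma pa_mulw (d1 d2 : {fset qpath Q}) f g :
  (msupp f `<=` d1)%fset -> (msupp g `<=` d2)%fset ->
  pa_mul f g =
    \sum_(p <- d1) \sum_(q <- d2) pa_omonom (f@_p * g@_q) (pcomp p q).
Proof.
move=> le1 le2; rewrite unlock (big_fset_incl _ le1) /=.
  apply/eq_bigr=> p _; apply/big_fset_incl => // q _ /mcoeff_outdom ->.
  by rewrite mulr0 pa_omonom0.
move=> p _ /mcoeff_outdom fp; rewrite big1 // => q _.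
by rewrite fp mul0r pa_omonom0.
Qed.

Lemma pa_mulDl : left_distributive pa_mul +%R.
Proof.
move=> f1 f2 g; have s0 := fsubset_refl (msupp g).
rewrite (pa_mulw (msuppD_le f1 f2) s0) (pa_mulw (fsubsetUl _ (msupp f2)) s0).
rewrite (pa_mulw (fsubsetUr (msupp f1) _) s0) -big_split /=.
apply/eq_bigr=> p _; rewrite -big_split /=; apply/eq_bigr=> q _.
by rewrite mcoeffD mulrDl pa_omonomD.
Qed.

Lemma pa_mulDr : right_distributive pa_mul +%R.
Proof.
move=> f g1 g2; have s0 := fsubset_refl (msupp f).
rewrite (pa_mulw s0 (msuppD_le g1 g2)) (pa_mulw s0 (fsubsetUl _ (msupp g2))).
rewrite (pa_mulw s0 (fsubsetUr (msupp g1) _)) -big_split /=.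
apply/eq_bigr=> p _; rewrite -big_split /=; apply/eq_bigr=> q _.
by rewrite mcoeffD mulrDr pa_omonomD.
Qed.

Lemma pa_mul_monom c d p q :
  pa_mul (pa_monom c p) (pa_monom d q) = pa_omonom (c * d) (pcomp p q).
Proof.
rewrite [pa_monom]unlock (pa_mulw msuppU_le msuppU_le) !big_seq_fset1.
by rewrite !mcoeffUU.
Qed.

Definition pa_gen (cp : K * qpath Q) : KQ := pa_monom cp.1 cp.2.

Lemma pa_span (P : KQ -> Prop) : P 0 ->
  (forall f g, P f -> P g -> P (f + g)) -> (forall cp, P (pa_gen cp)) ->
  forall f, P f.
Proof.
move=> P0 PD PU f; rewrite (monalgE f); elim/big_ind: _ => // p _.
by have := PU (f@_p, p); rewrite /pa_gen pa_monom.unlock.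
Qed.

Lemma pa_mulA : associative pa_mul.
Proof.
apply: (span_mulA pa_mulDl pa_mulDr pa_span) => -[c p] [d q] [e r].
rewrite /pa_gen /= (pa_mul_monom d) (pa_mul_monom c); move: (pcompA p q r).
case: (pcomp q r) => [u|]; case: (pcomp p q) => [v|] /= H.
- by rewrite (pa_mul_monom c) pa_mul_monom mulrA H.
- by rewrite (pa_mul_monom c) H /= (span_mul0l pa_mulDl).
- by rewrite pa_mul_monom -H /= (span_mul0r pa_mulDr).
- by rewrite (span_mul0l pa_mulDl) (span_mul0r pa_mulDr).
Qed.

Lemma pa_mul1l : left_id pa_one pa_mul.
Proof.
apply: (span_mul1l pa_mulDl pa_mulDr pa_span
  (j0 := fun cp => ptarget cp.2)) => -[c p] x.
by rewrite /pa_gen /= pa_mul_monom pcomp1p mul1r; case: ifP.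
Qed.

Lemma pa_mul1r : right_id pa_one pa_mul.
Proof.
apply: (span_mul1r pa_mulDl pa_mulDr pa_span
  (j0 := fun cp => psource cp.2)) => -[c p] x.
by rewrite /pa_gen /= pa_mul_monom pcompp1 mulr1; case: ifP.
Qed.

(* Only a [pzRingType]: the path algebra of the empty quiver is zero. *)
HB.instance Definition _ := GRing.Zmodule_isPzRing.Build KQ
  pa_mulA pa_mul1l pa_mul1r pa_mulDl pa_mulDr.

Lemma pa_scale_monom (c d : K) p :
  c *: (pa_monom d p : KQ) = pa_monom (c * d) p.
Proof.
rewrite pa_monom.unlock; apply/malgP => q.
apply: etrans (mcoeffZ c << d *g p >> q) _.
apply: etrans (congr1 ( *%R c) (mcoeffU p d q)) _.
by apply: etrans (esym (mcoeffU p (c * d) q)); rewrite mulrnAr.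
Qed.

Lemma pa_scale_omonom (c d : K) o :
  c *: (pa_omonom d o : KQ) = pa_omonom (c * d) o.
Proof. by case: o => [p|]; [exact: pa_scale_monom | exact: scaler0]. Qed.

Lemma pa_scaleAl (c : K) f g : c *: (f * g) = (c *: f) * g.
Proof.
apply: (span_scaleAl pa_mulDl pa_mulDr pa_span) => -[d p] [e q].
rewrite /pa_gen /= (pa_scale_monom c d p) (pa_mul_monom d).
rewrite (pa_mul_monom (c * d)) pa_scale_omonom.
by rewrite mulrA.
Qed.

Lemma pa_scaleAr (c : K) f g : c *: (f * g) = f * (c *: g).
Proof.
apply: (span_scaleAr pa_mulDl pa_mulDr pa_span) => -[d p] [e q].
rewrite /pa_gen /= (pa_scale_monom c e q) (pa_mul_monom d e).
rewrite (pa_mul_monom d (c * e)) pa_scale_omonom.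
by rewrite mulrCA.
Qed.

End PathAlgebra.

Section Modules.
Variables (K : fieldType) (Q : quiver).
Local Notation KQ := (path_algebra K Q).

(* K acts on a KQ-module through the structure map c |-> c *: 1 of KQ. *)
Definition finite_dimensional (M : lmodType KQ) : Prop :=
  exists s : seq M, forall x : M, exists c : 'I_(size s) -> K,
    x = \sum_(i < size s) (c i *: (1 : KQ)) *: s`_i.

Record fdmod := FdMod {
  fdmod_lmod :> lmodType KQ;
  fdmodP : finite_dimensional fdmod_lmod
}.

Definition isomorphic (M N : fdmod) : Prop :=
  exists f : {linear M -> N}, bijective f.

Definition short_exact (L M N : fdmod)
    (f : {linear L -> M}) (g : {linear M -> N}) : Prop :=
  [/\ injective f,
      forall y : M, g y = 0 <-> exists x, f x = y
    & forall z : N, exists y, g y = z].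

(* A full subcategory is given by its class of objects. *)
Definition iso_closed (C : fdmod -> Prop) : Prop :=
  forall M N, isomorphic M N -> C M -> C N.

Record torsion_pair := TorsionPair {
  torsion : fdmod -> Prop;
  torsion_free : fdmod -> Prop;
  torsion_iso : iso_closed torsion;
  torsion_free_iso : iso_closed torsion_free;
  torsion_hom0 : forall (X Y : fdmod) (f : {linear X -> Y}),
    torsion X -> torsion_free Y -> forall x, f x = 0;
  torsion_seq : forall X : fdmod, exists XT XF : fdmod,
    [/\ torsion XT, torsion_free XF
      & exists (f : {linear XT -> X}) (g : {linear X -> XF}), short_exact f g]
}.

End Modules.

Section PartPartition.
Variable Q : quiver.
Implicit Types (W : {set vertex Q}) (D : seq {set vertex Q}).

Definition full_arrows W : {set arrow Q} :=
  [set a | (source a \in W) && (target a \in W)].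

Definition sinks W : {set vertex Q} :=
  [set x in W | [forall a in full_arrows W, source a != x]].

Definition sources W : {set vertex Q} :=
  [set x in W | [forall a in full_arrows W, target a != x]].

Definition part D (i : nat) : {set vertex Q} := nth set0 D i.

Definition remaining D (i : nat) : {set vertex Q} :=
  ~: \bigcup_(j < i) part D j.

(* D is the sequence D_0, ..., D_m, so that m = (size D).-1. *)
Definition strong1_part_partition D : Prop :=
  [/\ (0 < size D)%N,
      forall i j, (i < j < size D)%N -> [disjoint part D i & part D j],
      forall i, (0 < i < size D)%N -> part D i != set0,
      forall i, (0 < i)%N -> (2 * i - 1 < size D)%N ->
        sinks (remaining D (2 * i - 1)%N) \subset part D (2 * i - 1)%N
    & forall i, (0 < i)%N -> (2 * i < size D)%N ->
        sources (remaining D (2 * i)%N) \subset part D (2 * i)%N].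

Definition complete_partition D : Prop := \bigcup_(i < size D) part D i = setT.

Definition complete_strong1_part_partition : Type :=
  {D : seq {set vertex Q} |
    strong1_part_partition D /\ complete_partition D}.

End PartPartition.

(* 1 -> 2 -> ... -> n, with vertices numbered from 0; there is one arrow for
   each pair of consecutive vertices. *)
Definition A_quiver (n : nat) : quiver :=
  @Quiver 'I_n {e : 'I_n * 'I_n | e.2 == e.1.+1 :> nat}
    (fun a => (val a).1) (fun a => (val a).2).

(* Main.v *)
From HB Require Import structures.
Require Import Defs.
From mathcomp Require Import all_boot all_algebra.
From mathcomp Require Import monalg.
From mathcomp Require Import boolp zify.

(* Both sets are counted by the Catalan number C_(n+1).

   Torsion pairs. Number the vertices 0, ..., n-1, let I[i,c) be the interval
   module with top i supported on [i,c), and put V_n = 0 for a representation V.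
   For b with i <= b i <= n, the representations V such that V_i -> V_(b i) is
   injective for every i form a torsion-free class F_b. Conversely a torsion
   pair (T, F) has F = F_b when b i is the largest c with I[i,c) in T, or i if
   there is none: a nonzero X in T with X in F_b would have a quotient I[i,c)
   for which X_i -> X_c is not injective. The b arising in this way are the
   bracket vectors, those with b k <= b i whenever i < k <= b i, and they are
   determined by F_b.

   Partitions. A complete partition is the function l sending a vertex to the
   index of its part. The conditions on sinks and sources say that consecutive
   values a, b of l, extended by 0 on both sides, satisfy
   2p - 1 <= b <= 2p + 2 with p = a/2 rounded down. So p performs a Motzkin path
   with two kinds of level steps.

   Words for bracket vectors and for level functions are both read by automata,
   and counting their accepted words by the remaining length expresses both
   numbers as ballot numbers with equal parameters. *)

Set Implicit Arguments.
Unset Strict Implicit.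
Unset Printing Implicit Defensive.

(** Elements whose codes have the same position in [s] and in [t] correspond, so what remains is to
    compare two lengths. *)
Lemma bijective_of_enum (A : eqType) (X Y : Type) (f : X -> A) (g : Y -> A)
    (s t : seq A) :
  uniq s -> uniq t -> size s = size t ->
  injective f -> (forall a, a \in s <-> exists x, f x = a) ->
  injective g -> (forall a, a \in t <-> exists y, g y = a) ->
  exists h : X -> Y, bijective h.
Proof.
move=> us ut st fI fs gI gt.
have ms x : f x \in s by apply/fs; exists x.
have mt y : g y \in t by apply/gt; exists y.
have hP x : {y | g y = nth (f x) t (index (f x) s)}.
  by apply: cid; apply/gt; rewrite mem_nth // -st index_mem.
have kP y : {x | f x = nth (g y) s (index (g y) t)}.
  by apply: cid; apply/fs; rewrite mem_nth // st index_mem.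
exists (fun x => sval (hP x)), (fun y => sval (kP y)).
  move=> x; case: (hP x) => y /= gy; case: (kP y) => z /= fz; apply: fI.
  by rewrite fz gy index_uniq ?nth_index // -st index_mem.
move=> y; case: (kP y) => x /= fx; case: (hP x) => z /= gz; apply: gI.
by rewrite gz fx index_uniq ?nth_index // st index_mem.
Qed.

(** * Automata and ballot numbers *)

Section Automaton.
Variables (S : Type) (L : eqType) (next : S -> seq L) (delta : S -> L -> S).
Variable final : S -> bool.

Fixpoint accepts (s : S) (w : seq L) : bool :=
  if w is a :: w' then (a \in next s) && accepts (delta s a) w' else final s.

Fixpoint words (m : nat) (s : S) : seq (seq L) :=
  if m is m'.+1 then
    [seq a :: w | a <- next s, w <- words m' (delta s a)]
  else if final s then [:: [::]] else [::].

Lemma mem_words m s w : (w \in words m s) = (size w == m) && accepts s w.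
Proof.
elim: m s w => [|m IH] s w /=.
  by case: ifP => fs; case: w => //=; rewrite ?inE ?fs.
apply/allpairsPdep/idP => [[a [v [an vm ->]]] /=|].
  by rewrite an eqSS -IH.
case: w => //= a w /andP[sw /andP[an acc]]; exists a, w.
by rewrite IH; split=> //; apply/andP.
Qed.

(** The invariant restricts attention to states met during a run: an arbitrary bracket stack may
    repeat a value, a reachable one does not. *)
Lemma uniq_words (inv : pred S) :
  (forall s, inv s -> uniq (next s)) ->
  (forall s a, inv s -> a \in next s -> inv (delta s a)) ->
  forall m s, inv s -> uniq (words m s).
Proof.
move=> un di; elim=> [|m IH] s si /=; first by case: ifP.
apply: allpairs_uniq_dep; first exact: un.
  by move=> a an; apply/IH/di.
by move=> -[a v] [b w] _ _ /= [-> ->].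
Qed.

Lemma size_words m s :
  size (words m.+1 s) = \sum_(a <- next s) size (words m (delta s a)).
Proof. by rewrite size_allpairs_dep sumnE big_map. Qed.

End Automaton.

(* The number of paths of length l from height h to height 0 with steps +1
   and -1 that never become negative. *)
Fixpoint ballot (l h : nat) : nat :=
  if l is l'.+1 then
    ballot l' h.+1 + (if h is h'.+1 then ballot l' h' else 0)
  else h == 0.

Lemma ballot_diag h : ballot h h = 1.
Proof.
(* The added half, that [h] steps cannot descend from a height above [h], discards the up-step in
   the induction. *)
suff [] : ballot h h = 1 /\ forall k, h < k -> ballot h k = 0 by [].
elim: h => [|h [IH1 IH2]]; first by split=> // -[].
split=> [|[//|k] hk] /=; first by rewrite IH1 IH2 //; lia.
by rewrite !IH2 //; lia.
Qed.

(* Up-steps come one at a time, followed by an arbitrary run of down-steps. *)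
Lemma ballot_sum m r :
  \sum_(0 <= t < r.+1) ballot (2 * m + t.+1) t.+1 = ballot (2 * m + 2 + r) r.
Proof.
elim: r => [|r IH].
  rewrite big_nat1 (_ : 2 * m + 2 + 0 = (2 * m + 1).+1); last by lia.
  by rewrite /= addn0.
rewrite big_nat_recr //= IH (_ : 2 * m + 2 + r.+1 = (2 * m + r.+2).+1);
  last by lia.
by rewrite /= addnC; congr (_ + ballot _ _); lia.
Qed.

(** * Words of level functions and of bracket vectors *)

Definition level_next (a : nat) : seq nat :=
  [seq b <- iota 0 (a./2.*2 + 3) | a./2.*2 <= b.+1].

(** The final states [a <= 1] are those whose successors include the closing 0. *)
Definition level_words (n : nat) : seq (seq nat) :=
  words level_next (fun _ b => b) (fun a => a <= 1) n 0.

(** One letter lowers [p], two keep it and one raises it; at [p = 0] the lowering letter is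
    missing. *)
Lemma level_next_enum p : level_next p.*2 = level_next p.*2.+1 /\
  level_next p.*2 = if p is q.+1 then
    [:: q.*2.+1; q.+1.*2; q.+1.*2.+1; q.+2.*2] else [:: 0; 1; 2].
Proof.
rewrite /level_next /= uphalf_double doubleK; split=> //.
case: p => [|q] //; have -> : q.+1.*2 + 3 = q.*2.+1 + 4 by lia.
rewrite iotaD filter_cat /= -[RHS]cat0s; congr (_ ++ _).
  apply/eqP; rewrite -[_ == _]negbK -has_filter -all_predC; apply/allP => x.
  by rewrite mem_iota /=; lia.
by do !(case: ifP => [_|]; last lia); do !(congr cons; try lia).
Qed.

(** With [p] placed at height [2p + 1], one letter amounts to two ballot steps: they change the
    height by 2, by 0 in two ways, or by -2, and the last is barred at height 1. *)
Lemma size_level_words m a :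
  size (words level_next (fun _ b => b) (fun a => a <= 1) m a) =
  ballot (2 * m + 1) a./2.*2.+1.
Proof.
elim: m a => [|m IH] a.
  by rewrite /=; case: ifP; case: a => [|[|a]] //=; rewrite doubleS.
rewrite size_words (_ : 2 * m.+1 + 1 = (2 * m + 1).+2); last by lia.
rewrite (eq_bigr (fun b => ballot (2 * m + 1) b./2.*2.+1)) => [|b _ //].
have -> : level_next a = level_next a./2.*2.
  rewrite -{1}(odd_double_half a); case: (odd a) => //=.
  by rewrite add1n (level_next_enum _).1.
rewrite (level_next_enum _).2; case: (a./2) => [|q] /=.
  by rewrite !big_cons big_nil /= -[1.*2]/2 -[0.*2]/0; lia.
by rewrite !big_cons big_nil /= !uphalf_double !doubleK !doubleS /=; lia.
Qed.

(* In a state (m, s), the values of b on [m, n) have been read, and s lists the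
   values allowed for b (m - 1) other than m - 1 itself. *)
Definition bracket_next (u : nat * seq nat) : seq nat :=
  if u.1 is m.+1 then m :: u.2 else [::].

(** After [b m = x], a smaller index cannot take a value [c] with [m <= c < x], since [m] would be
    nested in it while [b m] exceeds it. *)
Definition bracket_step (u : nat * seq nat) (x : nat) : nat * seq nat :=
  (u.1.-1, [seq c <- u.1.-1 :: u.2 | x <= c]).

Definition bracket_words (n : nat) : seq (seq nat) :=
  words bracket_next bracket_step xpredT n (n, [:: n]).

(** In an increasing list the [t]-th entry from the end has exactly [t] entries at or above it. *)
Lemma sum_size_filter_geq (F : nat -> nat) (u : seq nat) : sorted ltn u ->
  \sum_(a <- u) F (size [seq c <- u | a <= c]) = \sum_(0 <= t < size u) F t.+1.
Proof.
elim: u => [|x u IH] /=; first by rewrite big_nil big_geq.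
rewrite (path_sortedE ltn_trans) => /andP[/allP xu su].
rewrite big_cons /= leqnn big_nat_recr //= -IH // addnC; congr (_ + F _.+1).
  rewrite !big_seq; apply: eq_bigr => a /xu; rewrite ltnNge.
  by move=> /negbTE ->.
by congr size; apply/all_filterP/allP => a /xu /ltnW.
Qed.

Definition bracket_state (u : nat * seq nat) : bool :=
  sorted ltn u.2 && all (leq u.1) u.2.

Lemma sorted_bracket_next m s : bracket_state (m.+1, s) -> sorted ltn (m :: s).
Proof. by case/andP=> ss ms; rewrite /= (path_sortedE ltn_trans) ms. Qed.

Lemma bracket_state_step u x :
  bracket_state u -> x \in bracket_next u -> bracket_state (bracket_step u x).
Proof.
case: u => -[|m] s // us _; apply/andP; split.
  exact: sorted_filter ltn_trans _ _ (sorted_bracket_next us).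
case/andP: us => _ /allP ms; apply/allP => c; rewrite mem_filter inE.
by case/andP=> _ /orP[/eqP -> //|/ms /ltnW].
Qed.

(** A letter pushes one entry and pops any number of entries below itself, so a stack of size [r]
    becomes one of any size from 1 to [r + 1]. This is the sum in [ballot_sum]. *)
Lemma size_bracket_words m s : bracket_state (m, s) ->
  size (words bracket_next bracket_step xpredT m (m, s)) =
  ballot (2 * m + size s) (size s).
Proof.
elim: m s => [|m IH] s us; first by rewrite ballot_diag.
rewrite (_ : 2 * m.+1 = 2 * m + 2) ?size_words; last by lia.
rewrite -ballot_sum -[(size s).+1]/(size (m :: s)).
rewrite -(sum_size_filter_geq (fun r => ballot (2 * m + r) r)
  (sorted_bracket_next us)).
rewrite !big_seq; apply: eq_bigr => a am.
by apply: IH; apply: (bracket_state_step us).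
Qed.

Lemma size_level_bracket n : size (level_words n) = size (bracket_words n).
Proof.
by rewrite size_level_words size_bracket_words // /bracket_state /= leqnn.
Qed.

Lemma uniq_level_words n : uniq (level_words n).
Proof.
apply: (@uniq_words _ _ _ _ _ xpredT) => // a _.
by rewrite filter_uniq ?iota_uniq.
Qed.

Lemma uniq_bracket_words n : uniq (bracket_words n).
Proof.
apply: (@uniq_words _ _ _ _ _ bracket_state _ bracket_state_step).
  case=> -[|m] s // us; exact: sorted_uniq ltn_trans ltnn _ (sorted_bracket_next us).
by rewrite /bracket_state /= leqnn.
Qed.

(** * Bracket vectors and their words *)

Definition bracket_vector (n : nat) (b : nat -> nat) : Prop :=
  (forall i, i < n -> i <= b i <= n) /\
  (forall i k, i < k <= b i -> k < n -> b k <= b i).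

(** Values are listed from the last index down, the order in which the automaton reads them. *)
Fixpoint bracket_word (b : nat -> nat) (m : nat) : seq nat :=
  if m is m'.+1 then b m' :: bracket_word b m' else [::].

Lemma size_bracket_word b m : size (bracket_word b m) = m.
Proof. by elim: m => //= m ->. Qed.

Lemma eq_bracket_word b b' m : (forall i, i < m -> b i = b' i) ->
  bracket_word b m = bracket_word b' m.
Proof.
by elim: m => //= m IH e; rewrite e ?IH // => i im; apply/e/ltnW.
Qed.

Lemma bracket_word_inj b b' m : bracket_word b m = bracket_word b' m ->
  forall i, i < m -> b i = b' i.
Proof.
elim: m => //= m IH [eb eb'] i; rewrite ltnS leq_eqVlt => /orP[/eqP -> //|].
exact: IH.
Qed.

Lemma bracket_word_surj m w : size w = m -> exists b, bracket_word b m = w.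
Proof.
elim: m w => [|m IH] [|x w] //=.
move=> [/IH[b <-]]; exists (fun i => if i == m then x else b i).
rewrite eqxx; congr (_ :: _).
by apply: eq_bracket_word => i im; rewrite ltn_eqF.
Qed.

(* Reading b as a forest on [0, n], with b n = n and [i, b i] the subtree of
   i, these are the right ends of the trees in the part of the forest on
   [i, n]. *)
Definition bracket_stack (n : nat) (b : nat -> nat) (i : nat) : seq nat :=
  [seq c <- iota i (n.+1 - i) |
    all (fun k => b k <= c) [seq k <- iota i (c.+1 - i) | k < n]].

Lemma mem_bracket_stack n b i c : reflect
  (i <= c <= n /\ forall k, i <= k <= c -> k < n -> b k <= c)
  (c \in bracket_stack n b i).
Proof.
rewrite mem_filter mem_iota; apply: (iffP andP) => [[/allP H ic]|[ic H]].
  split; first lia; move=> k kc kn; apply: H.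
  by rewrite mem_filter mem_iota kn; lia.
split; last lia; apply/allP => k; rewrite mem_filter mem_iota => /andP[kn kc].
by apply: H => //; lia.
Qed.

Lemma sorted_bracket_stack n b i : sorted ltn (bracket_stack n b i).
Proof. exact: sorted_filter ltn_trans _ _ (iota_ltn_sorted _ _). Qed.

(** This is the recursion of [bracket_step]: passing from [i + 1] to [i] adds the candidate [c = i]
    and imposes [b i <= c] on all candidates. *)
Lemma bracket_stackS n b i : i < n -> i <= b i ->
  bracket_stack n b i = [seq c <- i :: bracket_stack n b i.+1 | b i <= c].
Proof.
move=> lin ib; apply: (irr_sorted_eq ltn_trans ltnn).
- exact: sorted_bracket_stack.
- apply: sorted_filter ltn_trans _ _ _.
  rewrite /= (path_sortedE ltn_trans) sorted_bracket_stack andbT.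
  by apply/allP => c /mem_bracket_stack[]; lia.
move=> c; rewrite [RHS]mem_filter in_cons; apply/mem_bracket_stack/andP.
  move=> [ic H]; split; first by apply: H; lia.
  case: eqVneq => //= nic; apply/mem_bracket_stack; split; first lia.
  by move=> k kc; apply: H; lia.
move=> [bc /orP[/eqP ec|/mem_bracket_stack[ic H]]].
  subst c; split; first lia; move=> k kc kn.
  by have -> : k = i by lia.
split; first lia; move=> k kc kn.
by have [->//|ki] := eqVneq k i; apply: H => //; lia.
Qed.

Lemma bracket_stack_ge n b i x : x \in i :: bracket_stack n b i.+1 -> i <= x.
Proof. by rewrite inE => /orP[/eqP -> //|/mem_bracket_stack[]]; lia. Qed.

(** Along the run on [b] the state is the explicit stack, so acceptance splits into one condition
    for each [b i]. *)
Lemma accepts_bracket_word n b m : m <= n ->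
  accepts bracket_next bracket_step xpredT (m, bracket_stack n b m)
    (bracket_word b m) <->
  forall i, i < m -> b i \in i :: bracket_stack n b i.+1.
Proof.
elim: m => [|m IH] mn; first by split.
rewrite -[accepts _ _ _ _ _]/((b m \in m :: bracket_stack n b m.+1) &&
  accepts bracket_next bracket_step xpredT
    (m, [seq c <- m :: bracket_stack n b m.+1 | b m <= c]) (bracket_word b m)).
split=> [/andP[bm]|H].
  rewrite -bracket_stackS ?(bracket_stack_ge bm) // => /IH-/(_ (ltnW mn)) H i.
  by rewrite ltnS leq_eqVlt => /orP[/eqP -> //|]; apply: H.
have bm := H m (ltnSn m); rewrite bm -bracket_stackS ?(bracket_stack_ge bm) //=.
by apply/IH => [|i im]; [exact: ltnW | apply: H; exact: ltnW].
Qed.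

(** That [b i] lies in the stack of [i + 1] unfolds to the nesting condition at [i]; for [b i = i]
    this condition is empty. *)
Lemma mem_bracket_words n w : w \in bracket_words n <->
  exists2 b, bracket_vector n b & bracket_word b n = w.
Proof.
have s0 b : [:: n] = bracket_stack n b n.
  rewrite /bracket_stack subSnn /= (_ : [seq _ <- _ | _] = [::]) //.
  by apply/eqP; rewrite -[_ == _]negbK -has_filter -all_predC; apply/allP => k;
     rewrite mem_iota /=; lia.
rewrite mem_words; split=> [/andP[/eqP /bracket_word_surj[b <-]]|[b [bn nc] <-]].
  rewrite (s0 b) => /accepts_bracket_word-/(_ (leqnn n)) H; exists b => //.
  split=> [i /[dup] lin /H|i k ik kn].
    rewrite inE => /orP[/eqP -> |/mem_bracket_stack[]]; first by rewrite leqnn ltnW.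
    by lia.
  have /H : i < n by lia.
  rewrite inE => /orP[/eqP bi|/mem_bracket_stack[_]]; first by lia.
  by apply=> //; lia.
rewrite size_bracket_word eqxx (s0 b) /=; apply/accepts_bracket_word => // i lin.
rewrite inE; case: eqVneq => //= bi; apply/mem_bracket_stack.
by split=> [|k ik]; [have := bn i lin; lia | apply: nc; lia].
Qed.

(** * Complete partitions of the linear quiver *)

Section CompletePartitions.
Variable Q : quiver.
Implicit Types (D : seq {set vertex Q}) (l : vertex Q -> nat).

(** A vertex in no part would get the value [size D], which completeness excludes. *)
Definition level D (x : vertex Q) : nat :=
  find (fun W : {set vertex Q} => x \in W) D.

Definition partition_of_levels l : seq {set vertex Q} :=
  mkseq (fun k => [set x | l x == k]) (\max_x l x).+1.

Lemma level_lt D x : complete_partition D -> level D x < size D.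
Proof.
move=> cD; have : x \in [set: vertex Q] by rewrite inE.
rewrite -cD -has_find => /bigcupP[i _ xi].
by apply/hasP; exists (part D i) => //; apply: mem_nth.
Qed.

Lemma mem_part D x k : strong1_part_partition D -> complete_partition D ->
  k < size D -> (x \in part D k) = (level D x == k).
Proof.
move=> [_ dD _ _ _] cD kD; have lD := level_lt x cD.
have xl : x \in part D (level D x).
  by rewrite /part (nth_find set0 (a := fun W : {set vertex Q} => x \in W)) // has_find.
apply/idP/eqP => [xk|<- //]; have [kl|lk|//] := ltngtP (level D x) k.
  have /disjointFr/(_ xl) := dD (level D x) k (introT andP (conj kl kD)).
  by rewrite xk.
have /disjointFr/(_ xk) := dD k (level D x) (introT andP (conj lk lD)).
by rewrite xl.
Qed.

Lemma remaining_level D k : strong1_part_partition D -> complete_partition D ->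
  k <= size D -> remaining D k = [set x | k <= level D x].
Proof.
move=> sD cD kD; apply/setP => x; rewrite !inE leqNgt; congr negb.
apply/bigcupP/idP => [[[i ik] _ /=]|lk].
  by rewrite mem_part ?(leq_trans ik) // => /eqP ->.
by exists (Ordinal lk) => //=; rewrite mem_part // (leq_trans lk).
Qed.

(** The last part, unless it is the one of index 0, is nonempty, so its index is attained as a
    level. *)
Lemma max_level D : strong1_part_partition D -> complete_partition D ->
  (\max_x level D x).+1 = size D.
Proof.
move=> sD cD; have [D0 _ nD _ _] := sD; apply/eqP; rewrite eqn_leq.
apply/andP; split.
  rewrite -(ltn_predK D0) ltnS; apply/bigmax_leqP => x _.
  by rewrite -ltnS (ltn_predK D0) level_lt.
have [D1|D1] := leqP (size D) 1; first exact: leq_trans D1 _.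
have /set0Pn[x] : part D (size D).-1 != set0 by apply: nD; lia.
rewrite mem_part ?ltn_predL // => /eqP lx.
by rewrite -(ltn_predK D0) ltnS -lx; apply: (leq_bigmax x).
Qed.

Lemma levelK D : strong1_part_partition D -> complete_partition D ->
  partition_of_levels (level D) = D.
Proof.
move=> sD cD; apply: (@eq_from_nth _ set0) => [|k]; rewrite size_mkseq.
  exact: max_level.
move=> kD; rewrite nth_mkseq //; apply/setP => x.
by rewrite inE -(mem_part x sD cD) -?max_level.
Qed.

Lemma part_levels l k : part (partition_of_levels l) k =
  if k <= \max_x l x then [set x | l x == k] else set0.
Proof.
rewrite /part; case: leqP => kl; first by rewrite nth_mkseq.
by rewrite nth_default // size_mkseq.
Qed.

Lemma mem_part_levels l x k :
  (x \in part (partition_of_levels l) k) = (l x == k).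
Proof.
rewrite part_levels; case: leqP => kl; rewrite inE //.
by apply/esym/ltn_eqF/(leq_ltn_trans _ kl)/(leq_bigmax x).
Qed.

Lemma complete_levels l : complete_partition (partition_of_levels l).
Proof.
apply/setP => x; rewrite inE; apply/bigcupP.
have lx : l x < size (partition_of_levels l).
  by rewrite size_mkseq ltnS (leq_bigmax x).
by exists (Ordinal lx) => //; rewrite mem_part_levels.
Qed.

Lemma remaining_levels l k :
  remaining (partition_of_levels l) k = [set x | k <= l x].
Proof.
apply/setP => x; rewrite !inE leqNgt; congr negb.
apply/bigcupP/idP => [[[i ik] _ /=]|lk].
  by rewrite mem_part_levels // => /eqP ->.
by exists (Ordinal lk) => //=; rewrite mem_part_levels.
Qed.

Lemma level_levels l x : level (partition_of_levels l) x = l x.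
Proof.
have := level_lt x (complete_levels l); rewrite /level -has_find => h.
have := nth_find set0 h.
by rewrite -[nth _ _ _]/(part _ _) mem_part_levels => /eqP.
Qed.

End CompletePartitions.

(** * Level functions on the linear quiver *)

Definition A_arrow n (x y : 'I_n) (xy : y == x.+1 :> nat) : arrow (A_quiver n) :=
  exist _ (x, y) xy.

Section LinearLevels.
Variables (n : nat) (l : 'I_n -> nat).
Local Notation Q := (A_quiver n).

Definition level_word : seq nat := [seq l x | x <- enum 'I_n].

Local Notation lv := (nth 0 level_word).
Local Notation pv := (nth 0 (0 :: level_word)).

Lemma size_level_word : size level_word = n.
Proof. by rewrite size_map size_enum_ord. Qed.

Lemma nth_level_word (x : 'I_n) : lv x = l x.
Proof. by rewrite (nth_map x) ?size_enum_ord // nth_ord_enum. Qed.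

(** Only the arrow to [x + 1] can prevent a sink. Past the last vertex [lv] is 0, hence below [k],
    as befits a vertex without outgoing arrow. *)
Lemma sinks_levels k (x : vertex Q) : 0 < k ->
  (x \in sinks [set y : vertex Q | k <= l y]) = (k <= l x) && (lv x.+1 < k).
Proof.
move=> k0; rewrite !inE; case: (leqP k (l x)) => //= kx.
apply/forallP/idP => [H|xk a].
  have [xn|xn] := ltnP x.+1 n; last by rewrite nth_default // size_level_word.
  pose y := Ordinal xn; pose a := @A_arrow n x y (eqxx _).
  rewrite ltnNge; apply/negP => ky.
  have := H a; rewrite inE /= !inE eqxx kx implybF.
  by rewrite -[x.+1]/(nat_of_ord y) nth_level_word in ky; rewrite ky.
apply/implyP; rewrite !inE => /andP[_ ka]; apply: contraTneq xk => ax.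
rewrite -leqNgt -ax; have := valP a; rewrite /= => /eqP <-.
by rewrite nth_level_word.
Qed.

(** The prepended 0 makes [pv x] the level of the predecessor of [x], or 0 at the first vertex. *)
Lemma sources_levels k (x : vertex Q) : 0 < k ->
  (x \in sources [set y : vertex Q | k <= l y]) = (k <= l x) && (pv x < k).
Proof.
move=> k0; rewrite !inE; case: (leqP k (l x)) => //= kx.
apply/forallP/idP => [H|xk a].
  case xE: (nat_of_ord x) => [|m] //=.
  have mn : m < n by apply: ltnW; rewrite -xE (ltn_ord x).
  pose y := Ordinal mn; pose a := @A_arrow n y x (introT eqP xE).
  rewrite ltnNge; apply/negP => ky.
  have := H a; rewrite inE /= !inE eqxx kx implybF andbT.
  by rewrite -[m]/(nat_of_ord y) nth_level_word in ky; rewrite ky.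
apply/implyP; rewrite !inE => /andP[ka _]; apply: contraTneq xk => ax.
rewrite -leqNgt -ax; have := valP a; rewrite /= => /eqP ->.
by rewrite /= nth_level_word.
Qed.

(* Read for consecutive vertices x, x+1 on levels a, b: x is not a sink of the
   vertices of level >= k for odd k < a, and x+1 is not a source of them for
   even k < b. *)
Lemma level_nextP a b : reflect
  ((forall k, odd k -> k < a -> k <= b) /\
   (forall k, ~~ odd k -> 0 < k < b -> k <= a))
  (b \in level_next a).
Proof.
rewrite mem_filter mem_iota; apply: (iffP idP) => [H|[Ha Hb]].
  by split=> k ok kb; lia.
(* The extreme cases suffice: the largest odd number below [a] and the largest even number below
   [b]. *)
have := Ha a./2.*2.-1; have := Hb (b.-1)./2.*2; lia.
Qed.

Lemma level_wordP : reflect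
  ((forall (x : 'I_n) k, odd k -> k < l x -> k <= lv x.+1) /\
   (forall (x : 'I_n) k, ~~ odd k -> 0 < k < l x -> k <= pv x))
  (level_word \in level_words n).
Proof.
rewrite mem_words size_level_word eqxx /=.
(* Acceptance is a path in the relation [level_next] from 0 through the word to a closing 0; [pv]
   and [lv] supply the two zeros. *)
have {1}-> w a : accepts level_next (fun _ b => b) (fun a => a <= 1) a w =
    path (fun a b => b \in level_next a) a (rcons w 0).
  elim: w a => [|b w IH] a /=; last by rewrite IH.
  by rewrite mem_filter mem_iota andbT; lia.
have nr i : nth 0 (rcons level_word 0) i = lv i.
  by rewrite nth_rcons if_same; case: ltnP => // /(nth_default 0) ->.
have np i : nth 0 (0 :: rcons level_word 0) i = pv i.
  by case: i => //= i; rewrite nr.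
apply: (iffP (pathP 0)); rewrite size_rcons size_level_word.
  move=> H; split=> x k ok kl.
    have := H x.+1 (ltn_ord x); rewrite nr np => /level_nextP[+ _].
    by apply=> //; rewrite /= nth_level_word.
  have := H x (ltnW (ltn_ord x)); rewrite nr np => /level_nextP[_].
  by apply=> //; rewrite nth_level_word.
move=> [Ha Hb] i lin; rewrite nr np; apply/level_nextP; split=> k ok.
  case: i lin => //= i lin; have e := nth_level_word (Ordinal (lin : i < n)).
  by rewrite /= in e; rewrite e; apply: Ha.
have [lin'|] := ltnP i n; last first.
  by move=> ni; rewrite [lv i]nth_default ?size_level_word //; lia.
have e := nth_level_word (Ordinal lin'); rewrite /= in e; rewrite e.
exact: Hb (Ordinal lin') k ok.
Qed.

(** For odd [k] the last vertex of level at least [k] has a successor of level below [k], so its own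
    level cannot exceed [k]. For even [k] the first such vertex serves in the same way. *)
Lemma levels_surj : level_word \in level_words n ->
  forall k, 0 < k <= \max_x l x -> exists x, l x = k.
Proof.
move=> /level_wordP[Ha Hb] k kl.
have [x0 kx0] : exists x0, k <= l x0.
  apply/existsP; apply: contraT; rewrite negb_exists => /forallP H.
  suff : \max_x l x <= k.-1 by lia.
  by apply/bigmax_leqP => x _; have := H x; lia.
case ok: (odd k).
  case: (@arg_maxnP _ x0 (fun x => k <= l x) (fun x => x) kx0) => x kx xmax.
  exists x; apply/eqP; rewrite eqn_leq kx andbT leqNgt; apply/negP => xk.
  have kx1 := Ha x k ok xk; have [xn|xn] := ltnP x.+1 n.
    have := xmax (Ordinal xn); rewrite /= -nth_level_word => /(_ kx1).
    by lia.
  by move: kx1; rewrite nth_default ?size_level_word //; lia.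
case: (@arg_minnP _ x0 (fun x => k <= l x) (fun x => x) kx0) => x kx xmin.
exists x; apply/eqP; rewrite eqn_leq kx andbT leqNgt; apply/negP => xk.
have := Hb x k; rewrite ok => /(_ isT).
case xE: (nat_of_ord x) => [|m] /=; first by lia.
have mn : m < n by apply: ltnW; rewrite -xE (ltn_ord x).
have := xmin (Ordinal mn); rewrite -nth_level_word /=; lia.
Qed.

Lemma strong1_levels : level_word \in level_words n ->
  strong1_part_partition (Q := Q) (partition_of_levels (Q := Q) l).
Proof.
move=> lw; have [Ha Hb] := level_wordP lw; split; rewrite ?size_mkseq //.
- move=> i j ij; rewrite disjoint_subset; apply/subsetP => x.
  by rewrite mem_part_levels inE mem_part_levels => /eqP ->; lia.
- move=> k kl; have [x lx] := levels_surj lw kl.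
  by apply/set0Pn; exists x; rewrite mem_part_levels lx.
- move=> i i0 _; apply/subsetP => x; rewrite remaining_levels.
  rewrite sinks_levels ?mem_part_levels; last by lia.
  move=> /andP[ix xi]; rewrite eqn_leq ix andbT leqNgt; apply/negP => /Ha.
  by rewrite leqNgt xi; lia.
move=> i i0 _; apply/subsetP => x; rewrite remaining_levels.
rewrite sources_levels ?mem_part_levels; last by lia.
move=> /andP[ix xi]; rewrite eqn_leq ix andbT leqNgt; apply/negP => ix'.
by have := Hb x (2 * i); lia.
Qed.

End LinearLevels.

(** A violated word condition would give a sink or source of the remaining vertices with level above
    [k], yet [part D k] must contain it. *)
Lemma level_word_partition n (D : seq {set vertex (A_quiver n)}) :
  strong1_part_partition D -> complete_partition D ->
  level_word (level D) \in level_words n.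
Proof.
move=> sD cD; have [_ _ _ HA HB] := sD; apply/level_wordP.
split=> x k ok kx; rewrite leqNgt; apply/negP => xk.
  have kD : k < size D.
    exact: ltn_trans kx (level_lt (Q := A_quiver n) x cD).
  have kE : k = 2 * k./2.+1 - 1 by lia.
  have := HA k./2.+1 isT; rewrite -kE => /(_ kD)/subsetP/(_ x).
  rewrite (remaining_level sD cD (ltnW kD)) sinks_levels; last by lia.
  by rewrite xk (ltnW kx) (mem_part _ sD cD kD) => /(_ isT)/eqP; lia.
have kD : k < size D.
  by case/andP: kx => _ kx; exact: ltn_trans kx (level_lt (Q := A_quiver n) x cD).
have kE : k = 2 * k./2 by lia.
have := HB k./2; rewrite -kE => /(_ _ kD)/subsetP => H.
have {H} := H _ x.
rewrite (remaining_level sD cD (ltnW kD)) sources_levels; last by lia.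
by rewrite xk (mem_part _ sD cD kD) => H; have /eqP := H ltac:(lia) ltac:(lia); lia.
Qed.

Definition csp_word n (D : complete_strong1_part_partition (A_quiver n)) :
    seq nat := level_word (level (sval D)).

Lemma csp_word_inj n : injective (@csp_word n).
Proof.
move=> [D [sD cD]] [E [sE cE]]; rewrite /csp_word /= => e; apply: eq_exist => /=.
suff lE : level D = level E by rewrite -(levelK sD cD) lE (levelK sE cE).
apply: funext => x; rewrite -(nth_level_word (level D) x) e.
exact: (nth_level_word (level E) x).
Qed.

Lemma mem_level_words n w :
  w \in level_words n <-> exists D, @csp_word n D = w.
Proof.
split=> [wn|[[D [sD cD]] <-]]; last exact: level_word_partition.
pose l (x : 'I_n) := nth 0 w x.
have wE : level_word l = w.
  have sw : size w = n by move: wn; rewrite mem_words => /andP[/eqP].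
  apply: (@eq_from_nth _ 0) => [|i]; rewrite size_level_word // => lin.
  exact: nth_level_word (Ordinal lin).
rewrite -wE in wn; have cl : complete_partition (partition_of_levels (Q := A_quiver n) l).
  exact: complete_levels.
pose D : complete_strong1_part_partition (A_quiver n) :=
  exist _ _ (conj (strong1_levels wn) cl).
exists D; rewrite -[RHS]wE /csp_word /=; congr (level_word _).
by apply: funext => x; apply: level_levels.
Qed.

Import GRing.Theory.
Local Open Scope ring_scope.

(** * Submodules, quotients and finite dimension *)

Section Submodules.
Variables (R : pzRingType) (V : lmodType R).

Definition submodule (P : V -> Prop) : Prop :=
  P 0 /\ forall (a : R) (u v : V), P u -> P v -> P (a *: u + v).

Section Closed.
Variables (P : V -> Prop) (P_sub : submodule P).

(** The closure proof is an argument so that the submodule structure can be attached to the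
    predicate. *)
Definition submod_pred of submodule P : {pred V} := [pred x | `[< P x >]].
Local Notation S := (submod_pred P_sub).

Lemma submod_predE x : (x \in S) = `[< P x >].
Proof. by []. Qed.

Lemma submod_pred_closed : submod_closed S.
Proof.
case: P_sub => P0 PL; split=> [|a u v]; rewrite !submod_predE; first exact/asboolP.
by move=> /asboolP Pu /asboolP Pv; apply/asboolP/PL.
Qed.

HB.instance Definition _ := GRing.isSubmodClosed.Build R V S submod_pred_closed.

Definition submod_type : Type := {x : V | x \in S}.

HB.instance Definition _ := [isSub of submod_type for @sval _ _].
HB.instance Definition _ := [Choice of submod_type by <:].
HB.instance Definition _ := [SubChoice_isSubLmodule of submod_type by <:].

Local Open Scope quotient_scope.

Definition quotmod_type : Type := Quotient.quot S.
HB.instance Definition _ := GRing.Zmodule.on quotmod_type.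

Definition quotmod_scale (a : R) (x : quotmod_type) : quotmod_type :=
  \pi_(Quotient.quot S) (a *: repr (x : Quotient.quot S)).

Lemma quotmod_scale_pi a (v : V) :
  quotmod_scale a (\pi_(Quotient.quot S) v) = \pi_(Quotient.quot S) (a *: v).
Proof.
apply/eqP; rewrite -Quotient.idealrBE -scalerBr rpredZ //.
by rewrite Quotient.idealrBE reprK.
Qed.

Lemma quotmod_scaleA a b x :
  quotmod_scale a (quotmod_scale b x) = quotmod_scale (a * b) x.
Proof.
by rewrite -[x](reprK (qT := Quotient.quot S)) !quotmod_scale_pi scalerA.
Qed.

Lemma quotmod_scale1 : left_id 1 quotmod_scale.
Proof.
by move=> x; rewrite -[x](reprK (qT := Quotient.quot S)) quotmod_scale_pi scale1r.
Qed.

Lemma quotmod_scaleDr : right_distributive quotmod_scale +%R.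
Proof.
move=> a x y; rewrite -[x](reprK (qT := Quotient.quot S)).
rewrite -[y](reprK (qT := Quotient.quot S)) -raddfD !quotmod_scale_pi.
by rewrite scalerDr raddfD.
Qed.

Lemma quotmod_scaleDl x : {morph quotmod_scale^~ x : a b / a + b}.
Proof.
move=> a b; rewrite -[x](reprK (qT := Quotient.quot S)) !quotmod_scale_pi.
by rewrite scalerDl raddfD.
Qed.

HB.instance Definition _ := GRing.Zmodule_isLmodule.Build R quotmod_type
  quotmod_scaleA quotmod_scale1 quotmod_scaleDr quotmod_scaleDl.

Definition quotmod_pi (v : V) : quotmod_type := \pi_(Quotient.quot S) v.

Lemma quotmod_pi_linear : linear quotmod_pi.
Proof.
move=> a u v; apply: etrans (raddfD \pi_(Quotient.quot S) _ _) _.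
congr (_ + _); exact/esym/quotmod_scale_pi.
Qed.

HB.instance Definition _ := GRing.isLinear.Build R V quotmod_type _ quotmod_pi
  quotmod_pi_linear.

Lemma exists_submodule : exists (N : lmodType R) (f : {linear N -> V}),
  injective f /\ forall y, P y <-> exists x, f x = y.
Proof.
exists submod_type, (val : {linear submod_type -> V}); split; first exact: val_inj.
move=> y; split=> [Py|[[x Sx] <-]]; last by apply/asboolP; rewrite -submod_predE.
have Sy : y \in S by rewrite submod_predE; apply/asboolP.
by exists (exist _ y Sy).
Qed.

Lemma exists_quotient : exists (N : lmodType R) (f : {linear V -> N}),
  (forall z, exists y, f y = z) /\ forall y, f y = 0 <-> P y.
Proof.
exists quotmod_type, (quotmod_pi : {linear V -> quotmod_type}); split.
  move=> z; exists (repr (z : Quotient.quot S)).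
  exact: (reprK (qT := Quotient.quot S)).
move=> y; split=> [y0|Py].
  apply/asboolP; rewrite -submod_predE -[y]subr0 Quotient.idealrBE; apply/eqP.
  exact: etrans y0 (esym (raddf0 _)).
apply: etrans (raddf0 (\pi_(Quotient.quot S))); apply/eqP.
by rewrite -Quotient.idealrBE subr0 submod_predE; apply/asboolP.
Qed.

End Closed.
End Submodules.

(** Take a matrix of maximal rank with row space inside [P]; adjoining a vector of [P] cannot raise
    the rank. *)
Lemma subspace_row_space (K : fieldType) m (P : 'rV[K]_m -> Prop) :
  submodule P -> exists A : 'M[K]_m, forall v, P v <-> (v <= A)%MS.
Proof.
move=> [P0 PL].
pose Q (r : nat) :=
  `[< exists2 A : 'M[K]_m, (forall v, (v <= A)%MS -> P v) & \rank A = r >].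
have Q0 : Q 0%N.
  apply/asboolP; exists 0; last exact: mxrank0.
  by move=> v; rewrite submx0 => /eqP ->.
have Qm r : Q r -> (r <= m)%N.
  by move=> /asboolP[A _ <-]; apply: rank_leq_row.
case: (ex_maxnP (ex_intro Q 0%N Q0) Qm) => r /asboolP[A AP rA] rmax.
exists A => v; split=> [Pv|]; last exact: AP.
pose B := (A + v)%MS.
have QB : Q (\rank B).
  apply/asboolP; exists <<B>>%MS; last by rewrite genmxE.
  move=> w; rewrite genmxE => /sub_addsmxP[[a b] ->] /=.
  have Pbv : P (b *m v).
    rewrite [b]mx11_scalar mul_scalar_mx -[_ *: v]addr0; apply: PL => //.
  by rewrite -[a *m A]scale1r; apply: PL => //; apply: AP; apply: submxMl.
have := rmax _ QB; rewrite -rA => rB.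
have /eqmxP e : (A == B)%MS by rewrite -(geq_leqif (mxrank_leqif_eq (addsmxSl A v))).
by rewrite e addsmxSr.
Qed.

(** * Modules of finite dimension over the scalars *)

Section FiniteDimension.
Variables (K : fieldType) (R : pzRingType) (k : {rmorphism K -> R}).

Definition lincomb (M : lmodType R) m (t : 'I_m -> M) (v : 'rV[K]_m) : M :=
  \sum_i k (v 0 i) *: t i.

Definition fin_spanned (M : lmodType R) : Prop :=
  exists m (t : 'I_m -> M), forall x, exists v, x = lincomb t v.

Lemma lincombP (M : lmodType R) m (t : 'I_m -> M) a u v :
  lincomb t (a *: u + v) = k a *: lincomb t u + lincomb t v.
Proof.
rewrite /lincomb scaler_sumr -big_split; apply: eq_bigr => i _.
by rewrite !mxE rmorphD rmorphM scalerDl scalerA.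
Qed.

Lemma lincomb0 (M : lmodType R) m (t : 'I_m -> M) : lincomb t 0 = 0.
Proof. by rewrite /lincomb big1 // => i _; rewrite mxE rmorph0 scale0r. Qed.

Lemma lincomb_sum (M : lmodType R) m (t : 'I_m -> M) I (r : seq I)
    (c : I -> K) (F : I -> 'rV[K]_m) :
  lincomb t (\sum_(i <- r) c i *: F i) =
  \sum_(i <- r) k (c i) *: lincomb t (F i).
Proof.
elim: r => [|i r IH]; first by rewrite !big_nil lincomb0.
by rewrite !big_cons lincombP IH.
Qed.

Lemma linear_lincomb (M N : lmodType R) (f : {linear M -> N}) m
    (t : 'I_m -> M) v : f (lincomb t v) = lincomb (f \o t) v.
Proof.
by rewrite /lincomb linear_sum; apply: eq_bigr => i _; rewrite linearZZ.
Qed.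

Lemma fin_spanned_quotient (M N : lmodType R) (f : {linear M -> N}) :
  (forall z, exists y, f y = z) -> fin_spanned M -> fin_spanned N.
Proof.
move=> fS [m [t tP]]; exists m, (f \o t) => z.
have [y <-] := fS z; have [v ->] := tP y.
by exists v; rewrite linear_lincomb.
Qed.

(** The coefficient vectors of elements of the image of [f] form a subspace of [K^m]; lifting the
    rows of a matrix for it gives generators of [N]. *)
Lemma fin_spanned_sub (M N : lmodType R) (f : {linear N -> M}) :
  injective f -> fin_spanned M -> fin_spanned N.
Proof.
move=> fI [m [t tP]].
have [|A AP] := @subspace_row_space K m (fun v => exists x, f x = lincomb t v).
  split; first by exists 0; rewrite raddf0 lincomb0.
  move=> a u v [x fx] [y fy]; exists (k a *: x + y).
  by rewrite linearP fx fy lincombP.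
have rP i : {x | f x = lincomb t (row i A)} by apply/cid/AP/row_sub.
exists m, (fun i => sval (rP i)) => x; have [v xv] := tP (f x).
have /AP/submxP[w vE] : exists x, f x = lincomb t v by exists x.
exists w; apply: fI; rewrite linear_lincomb xv vE mulmx_sum_row lincomb_sum.
by apply: eq_bigr => i _ /=; case: (rP i) => y /= ->.
Qed.

(** [M] is [K^m] modulo relations. The cokernel of the relation matrix gives coordinates on [M]; one
    that is nonzero at [y] is rescaled. *)
Lemma exists_functional (M : lmodType R) (y : M) : fin_spanned M ->
  y <> 0 -> exists2 h : M -> K,
    (forall a u v, h (k a *: u + v) = a * h u + h v) & h y = 1.
Proof.
move=> [m [t tP]] y0.
have [|A AP] := @subspace_row_space K m (fun v => lincomb t v = 0).
  split; first exact: lincomb0.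
  by move=> a u v u0 v0; rewrite lincombP u0 v0 scaler0 addr0.
have cP x : {v | x = lincomb t v} by apply/cid/tP.
pose c x := sval (cP x); have cE x : lincomb t (c x) = x := esym (svalP (cP x)).
have /rV0Pn[j dj] : c y *m cokermx A != 0.
  by rewrite -submxE; apply/negP => /AP; rewrite cE.
pose h x := (c x *m cokermx A) 0 j; exists (fun x => h x / h y); last first.
  by rewrite divff.
move=> a u v; rewrite mulrA -mulrDl; congr (_ / _).
(* The chosen coefficients [c] need not be linear, but their defect is a relation and dies in the
   cokernel. *)
have /AP : lincomb t (-1 *: (a *: c u + c v) + c (k a *: u + v)) = 0.
  by rewrite !lincombP !cE rmorphN rmorph1 scaleN1r addNr.
rewrite submxE mulmxDl -!scalemxAl mulmxDl -scalemxAl => /eqP.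
move=> /matrixP/(_ 0 j); rewrite [RHS]mxE mxE [X in X + _]mxE.
rewrite [X in -1 * X]mxE [X in -1 * (X + _)]mxE -/(h _) -/(h u) -/(h v).
by move=> /eqP; rewrite mulN1r addrC subr_eq0 => /eqP.
Qed.

End FiniteDimension.

HB.lock Definition kconst (K : fieldType) (Q : quiver) (c : K) :
    path_algebra K Q := c *: (1 : path_algebra K Q).

Section PathAlgebraScalars.
Variables (K : fieldType) (Q : quiver).
Local Notation KQ := (path_algebra K Q).

Lemma pa_monomM (c d : K) (p q : qpath Q) :
  (pa_monom c p : KQ) * pa_monom d q = pa_omonom (c * d) (Defs.pcomp p q).
Proof. exact: pa_mul_monom. Qed.

Local Notation kconst := (@kconst K Q).

Lemma kconstMl c (f : KQ) : kconst c * f = c *: f.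
Proof. by rewrite kconst.unlock -(pa_scaleAl c 1 f) mul1r. Qed.

Lemma kconstMr c (f : KQ) : f * kconst c = c *: f.
Proof. by rewrite kconst.unlock -(pa_scaleAr c f 1) mulr1. Qed.

Lemma kconst_zmod_morphism : zmod_morphism kconst.
Proof. by move=> a b; rewrite kconst.unlock scalerBl. Qed.

Lemma kconst_monoid_morphism : monoid_morphism kconst.
Proof.
by split=> [|a b]; rewrite ?kconstMl kconst.unlock ?scale1r ?scalerA.
Qed.

HB.instance Definition _ := GRing.isZmodMorphism.Build K KQ kconst
  kconst_zmod_morphism.
HB.instance Definition _ := GRing.isMonoidMorphism.Build K KQ kconst
  kconst_monoid_morphism.

Lemma fin_spannedP (M : lmodType KQ) :
  fin_spanned (kconst : {rmorphism K -> KQ}) M <-> finite_dimensional M.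
Proof.
split=> [[m [t tP]]|[s sP]]; last first.
  exists (size s), (fun i => s`_i) => x; have [c ->] := sP x.
  exists (\row_i c i); apply: eq_bigr => i _.
  by rewrite mxE /= kconst.unlock.
pose s := mkseq (fun i => if insub i is Some j then t j else 0) m.
have sm : size s = m by rewrite size_mkseq.
exists s => x; have [v ->] := tP x; exists (fun i => v 0 (cast_ord sm i)).
rewrite /lincomb (@reindex _ _ _ _ _ (cast_ord sm)) /=; last first.
  by exists (cast_ord (esym sm)) => i _; rewrite ?cast_ordK ?cast_ordKV.
apply: eq_bigr => i _.
have im : (i < m)%N by rewrite -[X in (_ < X)%N]sm.
rewrite nth_mkseq // insubT /= kconst.unlock; congr (_ *: t _).
exact: val_inj.
Qed.

End PathAlgebraScalars.

(** * The path algebra of the linear quiver *)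

Section LinearPaths.
Variable n : nat.
Local Notation Q := (A_quiver n).
Implicit Types (p q r : qpath Q) (x y : 'I_n).

Lemma A_target (a : arrow Q) : target a = (source a).+1 :> nat.
Proof. by rewrite /= (eqP (valP a)). Qed.

Lemma A_source_inj : injective (@source Q).
Proof.
move=> a b e; apply: val_inj; move: (A_target a) (A_target b) e => /=.
case: (val a) (val b) => [i j] [i' j'] /= ej ej' e; rewrite e in ej *.
by congr pair; apply: val_inj; rewrite /= ej ej'.
Qed.

Lemma A_walk_end (x : vertex Q) s :
  walk x s -> walk_end x s = (x + size s)%N :> nat.
Proof.
rewrite /walk_end; elim: s x => [|a s IH] x /=; first by rewrite addn0.
move=> /andP[/eqP <- /IH ->]; have := A_target a; rewrite /= => ->.
by rewrite addSnnS.
Qed.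

Lemma A_walk_uniq (x : vertex Q) s t :
  walk x s -> walk x t -> size s = size t -> s = t.
Proof.
elim: s x t => [|a s IH] x [|b t] //= /andP[/eqP ax ws] /andP[/eqP bx wt] [st].
have ab : a = b by apply: A_source_inj; rewrite /= ax bx.
by subst b; congr (_ :: _); apply: IH ws wt st.
Qed.

Lemma A_ptarget p : ptarget p = (psource p + size (parrows p))%N :> nat.
Proof. exact/A_walk_end/qpath_walk. Qed.

(** At most one arrow leaves a vertex, so a path is fixed by its start and its length, and the
    length is the difference of its ends. *)
Lemma A_path_uniq p q : psource p = psource q -> ptarget p = ptarget q -> p = q.
Proof.
move=> e e'; apply: qpathP => //; apply: (A_walk_uniq (x := psource p)).
- exact: qpath_walk.
- by rewrite e qpath_walk.
- by have := A_ptarget p; have := A_ptarget q; rewrite e e'; lia.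
Qed.

Lemma A_path_exists x y : (x <= y)%N ->
  exists p, psource p = x /\ ptarget p = y.
Proof.
move=> xy; have [d yE] : exists d, y = (x + d)%N :> nat by exists (y - x)%N; lia.
elim: d => [|d IH] in y yE {xy} *.
  exists (ptriv (Q := Q) x); split=> //; apply: val_inj.
  by rewrite /ptarget /walk_end /= yE addn0.
have zn : (x + d < n)%N by have := ltn_ord y; lia.
have [//|p [px pz]] := IH (Ordinal zn).
have zy : y == (Ordinal zn).+1 :> nat by rewrite yE addnS.
subst x; have w : walk (psource p) (rcons (parrows p) (A_arrow zy)).
  rewrite -cats1 walk_cat /= qpath_walk andbT.
  by rewrite -[walk_end _ _]/(ptarget p) pz eqxx.
exists (@QPath Q (psource p, _) w); split=> //.
by rewrite /ptarget /walk_end /psource /= map_rcons last_rcons.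
Qed.

(** Ends are natural numbers so that [n] may occur as a target; no path reaches it, which models
    [V_n = 0]. *)
Definition A_path (x z : nat) : option (qpath Q) :=
  if pselect (exists p, psource p = x :> nat /\ ptarget p = z :> nat)
  is left h then Some (sval (cid h)) else None.

Lemma A_path_self p : A_path (psource p) (ptarget p) = Some p.
Proof.
rewrite /A_path; case: pselect => [h|[]]; last by exists p.
case: (cid h) => q [/= qs qt]; congr Some.
by apply: A_path_uniq; apply: val_inj.
Qed.

Variant A_path_spec (x z : nat) : option (qpath Q) -> bool -> Prop :=
| APathSome p of psource p = x :> nat & ptarget p = z :> nat :
    A_path_spec x z (Some p) true
| APathNone : A_path_spec x z None false.

Lemma A_pathP (x z : nat) : A_path_spec x z (A_path x z) (x <= z < n)%N.
Proof.
rewrite /A_path; case: pselect => [h|h].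
  case: (cid h) => p [/= px pz]; have -> : (x <= z < n)%N.
    by have := A_ptarget p; have := ltn_ord (ptarget p); rewrite px pz; lia.
  exact: APathSome.
have -> : (x <= z < n)%N = false; last exact: APathNone.
apply/negP => /andP[xz zn]; case: h.
have xn := leq_ltn_trans xz zn.
have [p [px pz]] := @A_path_exists (Ordinal xn) (Ordinal zn) xz.
by exists p; rewrite px pz.
Qed.

End LinearPaths.

(* The path from x to z, which is 0 unless x <= z < n. Like [pa_monom], this is
   locked to keep unification away from finitely supported functions. *)
HB.lock Definition pa_path (K : fieldType) (n x z : nat) :
    path_algebra K (A_quiver n) :=
  pa_omonom 1 (A_path n x z).

Section LinearPathAlgebra.
Variables (K : fieldType) (n : nat).
Local Notation Q := (A_quiver n).
Local Notation KQ := (path_algebra K Q).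

Local Notation E := (@pa_path K n).
Local Notation kc := (@kconst K Q).

Lemma pa_path0 x z : ~~ (x <= z < n)%N -> E x z = 0.
Proof. by rewrite pa_path.unlock; case: (A_pathP n x z). Qed.

Lemma pa_pathM x y z : (x <= y <= z)%N -> E y z * E x y = E x z.
Proof.
move=> /andP[xy yz]; have [zn|nz] := ltnP z n; last first.
  by rewrite !(@pa_path0 _ z) ?mul0r //; lia.
rewrite pa_path.unlock; have := A_pathP n x y; rewrite xy (leq_ltn_trans yz zn) => hp.
have := A_pathP n y z; rewrite yz zn => hq.
have := A_pathP n x z; rewrite zn (leq_trans xy yz) => hr.
inversion hp as [p ps pt ep|]; inversion hq as [q qs qt eq|].
inversion hr as [r rs rt er|]; rewrite [LHS]pa_monomM mulr1; congr pa_omonom.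
have := pcompP q p; have -> : psource q == ptarget p by rewrite -val_eqE /= qs pt.
move=> hs; inversion hs as [s ss sa st es|]; congr Some.
by apply: A_path_uniq; apply: val_inj; rewrite /= ?ss ?st ?ps ?qt ?rs ?rt.
Qed.

Lemma pa_pathM0 x y y' z : y != y' -> E y' z * E x y = 0.
Proof.
rewrite pa_path.unlock => yy; case: (A_pathP n x y) => [p ps pt|]; last exact: mulr0.
case: (A_pathP n y' z) => [q qs qt|]; last exact: mul0r.
by rewrite [LHS]pa_monomM pcompN //= -val_eqE /= qs pt eq_sym.
Qed.

Lemma pa_path_sum1 : \sum_(x < n) E x x = 1.
Proof.
apply: eq_bigr => x _; have := A_path_self (ptriv (Q := Q) x).
by rewrite pa_path.unlock => ->.
Qed.

Lemma kconst_pathE c (p : qpath Q) :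
  pa_monom c p = kc c * E (psource p) (ptarget p) :> KQ.
Proof.
by rewrite pa_path.unlock A_path_self kconstMl [RHS]pa_scale_monom mulr1.
Qed.

Lemma pa_path_ind (P : KQ -> Prop) : P 0 ->
  (forall f g, P f -> P g -> P (f + g)) ->
  (forall c x z, (x <= z < n)%N -> P (kc c * E x z)) -> forall f, P f.
Proof.
move=> P0 PD PE; apply: pa_span => // -[c p]; rewrite /pa_gen /= kconst_pathE.
by apply: PE; rewrite A_ptarget leq_addr -A_ptarget /=.
Qed.

Lemma kconst_comm c (f : KQ) : kc c * f = f * kc c.
Proof. by rewrite kconstMl kconstMr. Qed.

Definition pa_coef (x z : nat) (f : KQ) : K :=
  if A_path n x z is Some p then f@_p else 0.

Lemma pa_coef0 x z : pa_coef x z 0 = 0.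
Proof. by rewrite /pa_coef; case: A_path => // p; exact: mcoeff0. Qed.

Lemma pa_coefD x z f g : pa_coef x z (f + g) = pa_coef x z f + pa_coef x z g.
Proof.
by rewrite /pa_coef; case: A_path => [p|]; [exact: mcoeffD | rewrite addr0].
Qed.

Lemma pa_coef_path x z c a b : (a <= b < n)%N ->
  pa_coef x z (kc c * E a b) = if (a == x) && (b == z) then c else 0.
Proof.
move=> abn; rewrite kconstMl pa_path.unlock; have := A_pathP n a b; rewrite abn => hp.
inversion hp as [p ps pt ep|] => /=.
rewrite /pa_coef; have := A_pathP n x z; case: (A_path n x z) => [q|] hq.
  inversion hq as [r rs rt er|].
  rewrite (pa_scale_monom c 1 p) mulr1 pa_monom.unlock.
  apply: etrans (mcoeffU p c q) _; case: eqVneq => [pq|pq].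
    by rewrite mulr1n -rs -rt -ps -pt pq !eqxx.
  case: andP => // -[/eqP ax /eqP bz]; case/eqP: pq.
  by apply: A_path_uniq; apply: val_inj => /=; congruence.
case: andP => // -[/eqP ax /eqP bz].
by rewrite -ax -bz abn in hq; inversion hq.
Qed.

End LinearPathAlgebra.

Lemma exists_linear (R : pzRingType) (M N : lmodType R) (f : M -> N) :
  linear f -> exists F : {linear M -> N}, F =1 f.
Proof.
move=> fL.
by exists (HB.pack f (GRing.isLinear.Build R M N _ f fL) : {linear M -> N}).
Qed.

(** * Interval modules *)

Section IntervalModule.
Variables (K : fieldType) (n : nat).
Local Notation Q := (A_quiver n).
Local Notation KQ := (path_algebra K Q).
Local Notation E := (@pa_path K n).
Local Notation kc := (@kconst K Q).

Lemma exists_pa_linear (M N : lmodType KQ) (f : M -> N) :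
  (forall c u v, f (kc c *: u + v) = kc c *: f u + f v) ->
  (forall x z, (x <= z < n)%N -> forall u, f (E x z *: u) = E x z *: f u) ->
  exists F : {linear M -> N}, F =1 f.
Proof.
move=> fD fE; apply: exists_linear => a u v.
have fD1 w w' : f (w + w') = f w + f w'.
  by have := fD 1 w w'; rewrite rmorph1 !scale1r.
have f0 : f 0 = 0 by apply: (addIr (f 0)); rewrite -fD1 !add0r.
rewrite fD1; congr (_ + _); elim/pa_path_ind: a => [|a b ea eb|c x z xz].
- by rewrite !scale0r.
- by rewrite !scalerDl fD1 ea eb.
by rewrite -!scalerA -fE // -[kc c *: _]addr0 fD f0 addr0.
Qed.

Section Interval.
Variables i c : nat.

Definition interval := {x : 'I_n | (i <= x < c)%N}.

(* The representation of the quiver with K at the vertices of [i, c) and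
   identity maps between them. *)
Definition imod : Type := {ffun interval -> K}.

HB.instance Definition _ := GRing.Zmodule.on imod.

(* Paths that leave the interval act by 0, as only the coefficients between
   vertices of the interval are used. *)
Definition imod_scale (f : KQ) (w : imod) : imod :=
  [ffun z => \sum_x pa_coef (val (val x)) (val (val z)) f * w x].

(** Extension of [w] by 0 outside the interval; the sum has at most one term. *)
Definition imod_ext (w : imod) (a : nat) : K :=
  \sum_(x : interval | val (val x) == a) w x.

Lemma imod_extE (w : imod) x : imod_ext w (val (val x)) = w x.
Proof.
by rewrite /imod_ext (big_pred1 x) // => y; rewrite !val_eqE.
Qed.

Lemma imod_ext_out (w : imod) a : ~~ (i <= a < c)%N -> imod_ext w a = 0.
Proof.
by move=> ia; apply: big1 => x /eqP xa; have := valP x; rewrite /= xa (negbTE ia).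
Qed.

Lemma imod_ext_ffun (F : nat -> K) a : (a < n)%N ->
  imod_ext [ffun z => F (val (val z))] a = if (i <= a < c)%N then F a else 0.
Proof.
move=> an; case: ifP => ia; last by apply: imod_ext_out; rewrite ia.
pose x : interval := Sub (Ordinal an) ia.
by rewrite -[a in imod_ext _ a]/(val (val x)) imod_extE ffunE.
Qed.

Lemma imod_extD u v a : imod_ext (u + v) a = imod_ext u a + imod_ext v a.
Proof. by rewrite -big_split; apply: eq_bigr => x _; rewrite ffunE. Qed.

Lemma imod_scale0l w : imod_scale 0 w = 0.
Proof.
by apply/ffunP => z; rewrite !ffunE big1 // => x _; rewrite pa_coef0 mul0r.
Qed.

Lemma imod_scaleDl w : {morph imod_scale^~ w : a b / a + b}.
Proof.
move=> a b; apply/ffunP => z; rewrite !ffunE -big_split; apply: eq_bigr => x _.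
by rewrite pa_coefD mulrDl.
Qed.

Lemma imod_scaleDr : right_distributive imod_scale +%R.
Proof.
move=> a u v; apply/ffunP => z; rewrite !ffunE -big_split; apply: eq_bigr => x _.
by rewrite ffunE mulrDr.
Qed.

Lemma imod_scale0r a : imod_scale a 0 = 0.
Proof. by apply: (addIr (imod_scale a 0)); rewrite -imod_scaleDr !add0r. Qed.

Lemma imod_scale_path k a b w : (a <= b < n)%N ->
  imod_scale (kc k * E a b) w =
  [ffun z => if val (val z) == b then k * imod_ext w a else 0].
Proof.
move=> abn; apply/ffunP => z; rewrite !ffunE.
under eq_bigr do rewrite pa_coef_path //.
rewrite (eq_sym _ b); case: (b == _); last first.
  by rewrite big1 // => x _; rewrite andbF mul0r.
rewrite /imod_ext mulr_sumr [RHS]big_mkcond; apply: eq_bigr => x _.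
by rewrite andbT eq_sym; case: (_ == _); rewrite ?mul0r.
Qed.

Lemma imod_scale1 : left_id 1 imod_scale.
Proof.
move=> w; apply/ffunP => z; rewrite -pa_path_sum1.
have -> : imod_scale (\sum_(x < n) E x x) w =
    \sum_(x < n) imod_scale (kc 1 * E x x) w.
  rewrite (big_morph _ (imod_scaleDl w) (imod_scale0l w)).
  by apply: eq_bigr => x _; rewrite rmorph1 mul1r.
rewrite sum_ffunE (bigD1 (val z)) //= imod_scale_path ?leqnn ?ltn_ord //.
rewrite ffunE eqxx mul1r imod_extE big1 ?addr0 // => x xz.
rewrite imod_scale_path ?leqnn ?ltn_ord // ffunE.
by rewrite val_eqE eq_sym (negbTE xz).
Qed.

Lemma imod_scaleA a b w : imod_scale a (imod_scale b w) = imod_scale (a * b) w.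
Proof.
elim/pa_path_ind: a => [|a1 a2 e1 e2|k x z xz].
- by rewrite mul0r !imod_scale0l.
- by rewrite mulrDl !imod_scaleDl e1 e2.
elim/pa_path_ind: b => [|b1 b2 e1 e2|k' x' z' xz'].
- by rewrite mulr0 imod_scale0l imod_scale0r.
- by rewrite mulrDr !imod_scaleDl imod_scaleDr e1 e2.
have -> : kc k * E x z * (kc k' * E x' z') = kc (k * k') * (E x z * E x' z').
  by rewrite rmorphM -!mulrA; congr (_ * _); rewrite !mulrA -(kconst_comm k').
have [zx|zx] := eqVneq x z'; last first.
  rewrite pa_pathM0 1?eq_sym // mulr0 imod_scale0l !imod_scale_path //.
  apply/ffunP => u; rewrite !ffunE.
  rewrite (imod_ext_ffun (fun m => if m == z' then _ else 0)); last by lia.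
  by rewrite (negbTE zx) if_same mulr0 if_same.
subst z'; rewrite pa_pathM ?imod_scale_path; try lia.
apply/ffunP => u; rewrite !ffunE.
rewrite (imod_ext_ffun (fun m => if m == x then _ else 0)); last by lia.
rewrite eqxx; case: eqP => // uz; case: ifP => ix; first by rewrite mulrA.
(* Here [x] lies outside the interval and the later [z] inside, so [x < i] and the start [x'] is
   outside too. *)
rewrite (@imod_ext_out _ x') ?mulr0 //; have := valP u; rewrite /= uz.
by move: ix; lia.
Qed.

HB.instance Definition _ := GRing.Zmodule_isLmodule.Build KQ imod
  imod_scaleA imod_scale1 imod_scaleDr imod_scaleDl.

Lemma imodZ_path k a b (w : imod) : (a <= b < n)%N -> (kc k * E a b) *: w =
  [ffun z => if val (val z) == b then k * imod_ext w a else 0].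
Proof. exact: imod_scale_path. Qed.

Lemma imodZ_path1 a b (w : imod) : (a <= b < n)%N ->
  E a b *: w = [ffun z => if val (val z) == b then imod_ext w a else 0].
Proof.
move=> abn; rewrite -[E a b]mul1r -(rmorph1 kc) imodZ_path //.
by apply/ffunP => z; rewrite !ffunE mul1r.
Qed.

Lemma imodZ_kconst k (w : imod) : kc k *: w = [ffun z => k * w z].
Proof.
rewrite -[kc k]mulr1 -pa_path_sum1 mulr_sumr scaler_suml; apply/ffunP => z.
rewrite sum_ffunE ffunE (bigD1 (val z)) //= imodZ_path ?leqnn ?ltn_ord //.
rewrite ffunE eqxx imod_extE big1 ?addr0 // => x xz.
rewrite imodZ_path ?leqnn ?ltn_ord // ffunE.
by rewrite val_eqE eq_sym (negbTE xz).
Qed.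

Lemma imod_extZ k (w : imod) a : imod_ext (kc k *: w) a = k * imod_ext w a.
Proof.
by rewrite imodZ_kconst [RHS]mulr_sumr; apply: eq_bigr => x _; rewrite ffunE.
Qed.

Definition idelta (a : nat) : imod := [ffun z => (val (val z) == a)%:R].

Lemma imod_sum_delta (w : imod) :
  w = \sum_(a < n) kc (imod_ext w a) *: idelta a.
Proof.
apply/ffunP => z; rewrite sum_ffunE (bigD1 (val z)) //= imodZ_kconst !ffunE.
rewrite eqxx mulr1 imod_extE big1 ?addr0 // => x xz.
by rewrite imodZ_kconst !ffunE val_eqE eq_sym (negbTE xz) mulr0.
Qed.

Lemma imod_finite_dimensional : finite_dimensional imod.
Proof.
apply/fin_spannedP; exists n, (fun a : 'I_n => idelta a) => w.
exists (\row_a imod_ext w a); rewrite {1}[w]imod_sum_delta.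
by apply: eq_bigr => a _; rewrite mxE.
Qed.

Definition ifdmod : fdmod K Q := FdMod imod_finite_dimensional.

Definition igen : imod := idelta i.

Lemma pa_path_igen a : (i <= a < n)%N -> E i a *: igen = 
  if (i < c)%N then idelta a else 0.
Proof.
move=> ia; rewrite imodZ_path1 // (imod_ext_ffun (fun x => (x == i)%:R)); last by lia.
rewrite eqxx leqnn /=; case: ifP => ic; apply/ffunP => z; rewrite !ffunE.
  by case: eqP.
by rewrite if_same.
Qed.

Hypotheses (ic : (i < c)%N) (cn : (c <= n)%N).

Lemma igen_id : E i i *: igen = igen.
Proof. by rewrite pa_path_igen ?leqnn ?ic //; lia. Qed.

Lemma igen_end : E i c *: igen = 0.
Proof.
have [cn'|nc] := ltnP c n; last by rewrite pa_path0 ?scale0r //; lia.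
rewrite pa_path_igen ?ic; last by lia.
apply/ffunP => z; rewrite !ffunE; have := valP z; case: eqP => //=; lia.
Qed.

Lemma imod_cyclic (w : imod) : exists a : KQ, w = a *: igen.
Proof.
exists (\sum_(a < n) kc (imod_ext w a) * E i a).
rewrite scaler_suml [LHS]imod_sum_delta; apply: eq_bigr => a _.
have [ia|ia] := leqP i a; first by rewrite -scalerA pa_path_igen ?ic ?ia /=.
by rewrite imod_ext_out ?rmorph0 ?mul0r ?scale0r //; lia.
Qed.

(** [I[i,c)] is presented by the generator [igen] at [i], killed by the path to [c]; the map sends
    the basis vector at [a] to [E i a *: y]. *)
Lemma imod_hom (Y : lmodType KQ) (y : Y) :
  E i i *: y = y -> E i c *: y = 0 ->
  exists f : {linear imod -> Y}, f igen = y.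
Proof.
move=> yi yc; pose f (w : imod) := \sum_(a < n) kc (imod_ext w a) *: (E i a *: y).
have ext_path a b w k : (a <= b < n)%N -> (k < n)%N ->
    imod_ext (E a b *: w) k =
    if (i <= k < c)%N then if k == b then imod_ext w a else 0 else 0.
  move=> abn kn; rewrite imodZ_path1 //.
  exact: (imod_ext_ffun (fun m => if m == b then _ else 0)).
have [||F fF] := @exists_pa_linear imod Y f.
- move=> k u v; rewrite /f scaler_sumr -big_split; apply: eq_bigr => a _ /=.
  by rewrite imod_extD imod_extZ rmorphD rmorphM scalerDl -scalerA.
- move=> a b abn w; have bn : (b < n)%N by lia.
  have an : (a < n)%N by lia.
  rewrite /f (bigD1 (Ordinal bn)) //= [X in _ + X]big1 ?addr0; last first.
    move=> k kb; rewrite ext_path ?ltn_ord // -[b]/(val (Ordinal bn)) val_eqE.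
    by rewrite (negbTE kb) if_same rmorph0 scale0r.
  rewrite ext_path // eqxx (bigD1 (Ordinal an)) //= scalerDr scaler_sumr.
  rewrite [X in _ + X]big1 ?addr0; last first.
    move=> k ka; rewrite !scalerA -kconst_comm -mulrA pa_pathM0; last first.
      by rewrite -val_eqE in ka.
    by rewrite mulr0 scale0r.
  have [ia|ia] := boolP (i <= a < c)%N; last first.
    by rewrite imod_ext_out // if_same !rmorph0 !scale0r scaler0.
  rewrite !scalerA -kconst_comm -mulrA pa_pathM; last by lia.
  case: ifP => // ib.
  rewrite rmorph0 mul0r scale0r -(@pa_pathM _ _ i c b) //; last by lia.
  by rewrite -!scalerA yc !scaler0.
exists F; rewrite fF /f; have lin : (i < n)%N by lia.
rewrite (bigD1 (Ordinal lin)) //= (imod_ext_ffun (fun x => (x == i)%:R)) //.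
rewrite leqnn ic eqxx rmorph1 scale1r yi big1 ?addr0 // => k ki.
rewrite (imod_ext_ffun (fun x => (x == i)%:R)) // -[i in _ == i]/(val (Ordinal lin)).
by rewrite val_eqE (negbTE ki) if_same rmorph0 scale0r.
Qed.

(** The component at [z] pushes [u] along the path to [c - 1] and applies [h]. Paths entering the
    interval act by 0 on [I[i,c)], which matches the vanishing of [X] at vertices before [i]. *)
Lemma imod_cohom (X : lmodType KQ) (h : X -> K) (v : X) :
  (forall k (u w : X), h (kc k *: u + w) = k * h u + h w) ->
  (forall a (u : X), (a < i)%N -> E a a *: u = 0) ->
  E i i *: v = v -> h (E i c.-1 *: v) = 1 ->
  exists f : {linear X -> imod}, f v = igen.
Proof.
move=> hL Xi vi hv.
have h0 : h 0 = 0.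
  by have := hL (-1) 0 0; rewrite scaler0 add0r mulN1r addNr.
pose f (u : X) : imod := [ffun z => h (E (val (val z)) c.-1 *: u)].
have [||F fF] := @exists_pa_linear X imod f.
- move=> k u w; apply/ffunP => z; rewrite imodZ_kconst !ffunE -hL.
  by rewrite scalerDr !scalerA kconst_comm.
- move=> a b abn u; rewrite imodZ_path1 //; apply/ffunP => z; rewrite !ffunE.
  rewrite scalerA; case: eqP => [zb|/eqP zb]; last first.
    by rewrite pa_pathM0 1?eq_sym // scale0r.
  rewrite (imod_ext_ffun (fun m => h (E m c.-1 *: u))); last by lia.
  have := valP z; rewrite /= -/(val (val z)) zb => ib.
  rewrite pa_pathM; last by lia.
  case: ifP => // ia; have ai : (a < i)%N by lia.
  by rewrite -(@pa_pathM _ _ a a c.-1) -?scalerA ?Xi ?scaler0 //; lia.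
exists F; rewrite fF; apply/ffunP => z; rewrite !ffunE.
have := valP z => /= iz; case: eqP => [->//|/eqP zi].
by rewrite -vi scalerA pa_pathM0 1?eq_sym // scale0r.
Qed.

Lemma imod_inj k l (w : imod) :
  (k <= l < c)%N -> E k l *: w = 0 -> E k k *: w = 0.
Proof.
move=> kl; rewrite !imodZ_path1; try lia.
move=> /ffunP H; apply/ffunP => z; rewrite !ffunE; case: eqP => // zk.
have := valP z; rewrite /= -/(val (val z)) zk => ik.
have ln : (l < n)%N by lia.
have il : (i <= Ordinal ln < c)%N by move=> /=; lia.
by have := H (Sub (Ordinal ln) il); rewrite !ffunE /= eqxx.
Qed.

End Interval.
End IntervalModule.

(** * Torsion pairs *)

Lemma isomorphic_sym (K : fieldType) (Q : quiver) (M N : fdmod K Q) :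
  isomorphic M N -> isomorphic N M.
Proof.
move=> [f [g fK gK]]; have [|G GE] := @exists_linear _ N M g.
  by move=> a u v; apply: (can_inj fK); rewrite linearP !gK.
by exists G, f => x; rewrite GE.
Qed.

Lemma isomorphic_bij (K : fieldType) (Q : quiver) (M N : fdmod K Q)
    (f : {linear M -> N}) :
  injective f -> (forall y, exists x, f x = y) -> isomorphic M N.
Proof.
move=> fI fS; exists f; have gP y : {x | f x = y} by apply: cid.
by exists (fun y => sval (gP y)) => [x|y]; [apply: fI|]; case: (gP _).
Qed.

Section TorsionPairs.
Variables (K : fieldType) (Q : quiver).
Local Notation KQ := (path_algebra K Q).
Implicit Types (tp : torsion_pair K Q) (X Y Z : fdmod K Q).

(** If all maps into the torsion-free class vanish, so does [X -> XF], and [XT -> X] is an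
    isomorphism. *)
Lemma torsionE tp X : torsion tp X <->
  forall Y (f : {linear X -> Y}), torsion_free tp Y -> forall x, f x = 0.
Proof.
split=> [TX Y f FY|H]; first exact: torsion_hom0 TX FY.
have [XT [XF [TXT FXF [f [g [fI fg gS]]]]]] := torsion_seq tp X.
apply: (torsion_iso _ TXT); apply: (isomorphic_bij fI) => x.
by apply/fg; apply: H.
Qed.

Lemma torsion_quotient tp X Z (f : {linear X -> Z}) :
  torsion tp X -> (forall z, exists x, f x = z) -> torsion tp Z.
Proof.
move=> /torsionE TX fS; apply/torsionE => Y g FY z; have [x <-] := fS z.
exact: (TX Y (g \o f : {linear X -> Y}) FY).
Qed.

Lemma torsion_pair_eq tp tp' :
  torsion_free tp = torsion_free tp' -> tp = tp'.
Proof.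
move=> eF; have eT : torsion tp = torsion tp'.
  by apply: funext => X; apply: propext; rewrite !torsionE eF.
case: tp tp' eF eT => [T F ? ? ? ?] [T' F' ? ? ? ?] /= eF eT; subst T' F'.
by congr TorsionPair; apply: Prop_irrelevance.
Qed.

End TorsionPairs.

(** * Torsion-free classes of the linear quiver *)

Section LinearTorsion.
Variables (K : fieldType) (n : nat).
Local Notation Q := (A_quiver n).
Local Notation KQ := (path_algebra K Q).
Local Notation E := (@pa_path K n).
Local Notation fd := (fdmod K Q).
Implicit Types (b : nat -> nat) (X Y : fd).

(* The element [E i i *: x] is the component of x at the vertex i. When b i = n
   the condition says that this component vanishes, since [E i n] is 0. *)
Definition bracket_free b X : Prop :=
  forall i (x : X), (i < n)%N -> E i (b i) *: x = 0 -> E i i *: x = 0.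

(* The torsion part of X is the least submodule U with X / U in F_b; it exists
   because the condition on U is stable under intersections. *)
Lemma bracket_free_torsion_pair b : (forall i, (i < n)%N -> (i <= b i)%N) ->
  exists tp : torsion_pair K Q, torsion_free tp = bracket_free b.
Proof.
move=> ib.
pose T X := forall Y (f : {linear X -> Y}), bracket_free b Y -> forall x, f x = 0.
have Tiso : iso_closed T.
  move=> M N [f [g fK gK]] TM Y h FY x; rewrite -[x]gK.
  exact: (TM Y (h \o f : {linear M -> Y}) FY).
have Fiso : iso_closed (bracket_free b).
  move=> M N [f [g fK gK]] FM i x lin; rewrite -[x]gK -!linearZZ.
  move=> /(canRL fK); rewrite -{1}(raddf0 f) fK => /(FM _ _ lin) ->.
  by rewrite raddf0.
have hom0 (X Y : fd) (f : {linear X -> Y}) : T X -> bracket_free b Y ->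
    forall x, f x = 0 by move=> TX; apply: TX.
have seq (X : fd) : exists XT XF : fd, [/\ T XT, bracket_free b XF
    & exists (f : {linear XT -> X}) (g : {linear X -> XF}), short_exact f g].
  pose cond (N : X -> Prop) := forall i x, (i < n)%N ->
    N (E i (b i) *: x) -> N (E i i *: x).
  pose U v := forall N, submodule N -> cond N -> N v.
  have Us : submodule U.
    split=> [N [] //|a u v Uu Uv N sN cN]; have [_ NL] := sN.
    by apply: NL; [exact: Uu | exact: Uv].
  have Uc : cond U.
    by move=> i x lin Ux N sN cN; exact: cN i x lin (Ux N sN cN).
  have [T0 [f [fI fU]]] := exists_submodule Us.
  have [F0 [g [gS gU]]] := exists_quotient Us.
  have fdX := fdmodP X.
  have fdT : finite_dimensional T0.
    by apply/fin_spannedP/(fin_spanned_sub fI)/fin_spannedP.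
  have fdF : finite_dimensional F0.
    by apply/fin_spannedP/(fin_spanned_quotient gS)/fin_spannedP.
  exists (FdMod fdT), (FdMod fdF); split; last first.
  - exists f, g; split=> //= y; split=> [/gU/fU //|].
    by move=> /fU/gU.
  - move=> i z lin /=; have [x <-] := gS z; rewrite -!linearZZ => /gU Ux.
    by apply/gU; exact: Uc i x lin Ux.
  move=> Y h FY /=.
  (* The kernel of [h], seen inside [X], is again a submodule satisfying [cond], so by minimality it
     is all of [U]. *)
  pose N v := U v /\ forall x, f x = v -> h x = 0.
  suff NU v : U v -> N v.
    by move=> x; have [|_] := NU (f x); [apply/fU; exists x | apply].
  apply.
    split.
      split=> [|x]; first by case: Us.
      by rewrite -(raddf0 f) => /fI ->; exact: raddf0.
    move=> a u w [Uu hu] [Uw hw]; split; first by case: Us => _; apply.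
    have [xu xuE] := (fU u).1 Uu; have [xw xwE] := (fU w).1 Uw.
    move=> x; rewrite -xuE -xwE -linearP => /fI ->.
    by rewrite linearP (hu xu) // (hw xw) // scaler0 addr0.
  move=> i x lin [Ux hx]; split=> [|z zx]; first exact: Uc.
  have zi : E i i *: z = z.
    by apply: fI; rewrite linearZZ zx scalerA pa_pathM ?leqnn.
  rewrite -zi linearZZ; apply: FY => //; rewrite -linearZZ; apply: hx.
  by rewrite linearZZ zx scalerA pa_pathM // leqnn ib.
by exists (TorsionPair Tiso Fiso hom0 seq).
Qed.

(* Take i minimal with X_i nonzero, then c minimal such that X_i -> X_c is not
   injective. A functional on X_(c-1) that does not kill the image of X_i gives
   a map of X onto I[i,c): no condition arises at i by minimality. *)
Lemma torsion_bracket_free0 (tp : torsion_pair K Q) b X :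
  (forall i c, (i < c <= n)%N -> torsion tp (ifdmod K n i c) -> (c <= b i)%N) ->
  torsion tp X -> bracket_free b X -> forall x : X, x = 0.
Proof.
move=> bT TX FX x; apply: contrapT => x0.
pose P i := `[< (i < n)%N /\ exists u : X, E i i *: u <> 0 >].
have [i0 Pi0] : exists i, P i.
  apply: contrapT => NP; apply: x0; rewrite -[x]scale1r -pa_path_sum1 scaler_suml.
  apply: big1 => i _; apply: contrapT => Ei.
  by apply: NP; exists i; apply/asboolP; split=> //; exists x.
case: (ex_minnP (ex_intro P i0 Pi0)) => i /asboolP[lin [u0 u0P]] imin.
pose P' c := `[< (i <= c)%N /\ exists2 u : X, E i i *: u <> 0 & E i c *: u = 0 >].
(* [E i n] is 0, so [c = n] always qualifies. *)
have P'n : P' n.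
  apply/asboolP; split; first exact: ltnW.
  by exists u0 => //; rewrite pa_path0 ?scale0r // ltnn andbF.
case: (ex_minnP (ex_intro P' n P'n)) => c /asboolP[ic [u u0' uc]] cmin.
have cn := cmin _ P'n; have {}ic : (i < c)%N.
  by rewrite ltn_neqAle ic andbT; apply/eqP => ec; rewrite -ec in uc.
have uc1 : E i c.-1 *: u <> 0.
  move=> e; suff /cmin : P' c.-1 by lia.
  by apply/asboolP; split; [lia | exists u].
have /fin_spannedP fdX := fdmodP X.
have [h hL hu] := exists_functional fdX uc1.
have [||||f fu] := @imod_cohom K n i c ic cn X h (E i i *: u).
- exact: hL.
- move=> a v ai; apply: contrapT => va; suff /imin : P a by lia.
  by apply/asboolP; split; [lia | exists v].
- by rewrite scalerA pa_pathM ?leqnn.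
- by rewrite scalerA pa_pathM //; lia.
(* [I[i,c)] is a quotient of [X], hence torsion. So the nonzero component of [u] at [i] dies by
   [c <= b i], against [FX]. *)
have cb : (c <= b i)%N.
  apply: bT; first by rewrite ic.
  apply: (torsion_quotient (f := f : {linear X -> ifdmod K n i c}) TX) => w.
  have [a ->] := imod_cyclic ic cn w.
  by exists (a *: (E i i *: u)); rewrite linearZZ fu.
apply: u0'; apply: FX => //; rewrite -(@pa_pathM _ _ i c) ?(ltnW ic) //.
by rewrite -scalerA uc scaler0.
Qed.

Lemma torsion_pair_bracket (tp : torsion_pair K Q) :
  exists2 b, bracket_vector n b & torsion_free tp = bracket_free b.
Proof.
have bP i : {c | (i < n)%N -> [/\ (i <= c <= n)%N,
    c = i \/ (i < c)%N /\ torsion tp (ifdmod K n i c)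
    & forall c', (i < c' <= n)%N -> torsion tp (ifdmod K n i c') -> (c' <= c)%N]}.
  apply: cid; have [lin|] := ltnP i n; last by exists 0%N.
  pose P c := (c == i) || (i < c <= n)%N && `[< torsion tp (ifdmod K n i c) >].
  have Pi : P i by rewrite /P eqxx.
  have Pn c : P c -> (c <= n)%N by rewrite /P; lia.
  case: (ex_maxnP (ex_intro P i Pi) Pn) => c Pc cmax; exists c => _.
  split=> [||c' ic' Tc'].
  - by move: Pc; rewrite /P; lia.
  - case/orP: Pc => [/eqP ->|/andP[/andP[ic _] /asboolP Tc]]; first by left.
    by right.
  by apply: cmax; apply/orP; right; rewrite ic'; apply/asboolP.
pose b i := sval (bP i).
have b1 i : (i < n)%N -> (i <= b i <= n)%N by move=> /(svalP (bP i))[].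
have b2 i : (i < n)%N -> b i = i \/ (i < b i)%N /\ torsion tp (ifdmod K n i (b i)).
  by move=> /(svalP (bP i))[].
have b3 i c : (i < c <= n)%N -> torsion tp (ifdmod K n i c) -> (c <= b i)%N.
  move=> ic; have lin : (i < n)%N by lia.
  by have [_ _ H] := svalP (bP i) lin; exact: H.
have Fb : torsion_free tp = bracket_free b.
  apply: funext => X; apply: propext; split=> [FX i x lin xb|FX].
    (* An element at [i] killed by the path to [b i] is the image of the generator of the torsion
       module [I[i,b i)], hence 0. *)
    have [bi|[ibi Tb]] := b2 i lin; first by rewrite bi in xb.
    have bn : (b i <= n)%N by have := b1 i lin; lia.
    have [||f <-] := @imod_hom K n i (b i) ibi bn X (E i i *: x).
    - by rewrite scalerA pa_pathM ?leqnn.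
    - by rewrite scalerA pa_pathM // leqnn ltnW.
    exact: (torsion_hom0 (f : {linear ifdmod K n i (b i) -> X}) Tb FX).
  (* Conversely, the torsion part of [X] inherits the injectivity conditions, so it is 0 and [X] is
     isomorphic to [XF]. *)
  have [XT [XF [TXT FXF [f [g [fI fg gS]]]]]] := torsion_seq tp X.
  have XT0 : forall x : XT, x = 0.
    apply: torsion_bracket_free0 b3 TXT _ => i x lin xb.
    by apply: fI; rewrite raddf0 linearZZ; apply: FX => //; rewrite -linearZZ xb raddf0.
  apply: (torsion_free_iso _ FXF); apply/isomorphic_sym/(@isomorphic_bij _ _ _ _ g) => //.
  move=> u v e; apply/eqP; rewrite -subr_eq0; apply/eqP.
  have [|x <-] := (fg (u - v)).1; first by rewrite linearB e subrr.
  by rewrite (XT0 x) raddf0.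
exists b => //; split=> // i k ik kn; rewrite leqNgt; apply/negP => bik.
have lin : (i < n)%N by lia.
have bn : (b i < n)%N by have := b1 k kn; lia.
have ib : (i < (b i).+1)%N by lia.
(* If [b k > b i], let [y] be the image of the generator of [I[i,b i + 1)] in a torsion-free module.
   The path to [b k] kills [y]; injectivity at [k] makes it vanish already at [k <= b i], and
   injectivity at [i] gives [y = 0]. This contradicts the maximality of [b i]. *)
suff /b3 : torsion tp (ifdmod K n i (b i).+1) by lia.
apply/torsionE => Y f; rewrite Fb => FY w.
have [a ->] := imod_cyclic ib bn w; rewrite linearZZ.
suff -> : f (igen K n i (b i).+1) = 0 by rewrite scaler0.
rewrite -(igen_id K ib bn) linearZZ; apply: (FY) => //.
rewrite -(@pa_pathM _ _ i k); last by lia.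
rewrite -scalerA; suff -> : E i k *: f (igen K n i (b i).+1) = 0 by rewrite scaler0.
rewrite -(@pa_pathM _ _ i k k) ?leqnn ?andbT; last by lia.
rewrite -scalerA; apply: FY => //; rewrite scalerA pa_pathM; last by lia.
rewrite -(@pa_pathM _ _ i (b i).+1); last by lia.
by rewrite -scalerA -linearZZ (igen_end K ib bn) raddf0 scaler0.
Qed.

(** The test module is [I[i,b' i + 1)]. Nesting keeps [b' k] inside the interval for each [k] in it,
    so it lies in the class of [b']; if [b i > b' i], its generator dies on the way to [b i]. *)
Lemma bracket_free_le b b' : bracket_vector n b -> bracket_vector n b' ->
  bracket_free b = bracket_free b' -> forall i, (i < n)%N -> (b i <= b' i)%N.
Proof.
move=> [b1 b2] [b1' b2'] e i lin; rewrite leqNgt; apply/negP => bi.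
have ic : (i < (b' i).+1)%N by have := b1' i lin; lia.
have cn : ((b' i).+1 <= n)%N by have := b1 i lin; lia.
have : bracket_free b' (ifdmod K n i (b' i).+1).
  move=> k x kn; have [kc|kc] := boolP (i <= k < (b' i).+1)%N; last first.
    move=> _; rewrite imodZ_path1 ?leqnn // imod_ext_out //.
    by apply/ffunP => z; rewrite !ffunE if_same.
  apply: imod_inj ic cn _ _ _ _; have := b1' k kn.
  by have [->|ki] := eqVneq k i; [lia | have := b2' i k; lia].
rewrite -e => /(_ i (igen K n i (b' i).+1) lin).
rewrite -(@pa_pathM _ _ i (b' i).+1); last by lia.
rewrite -scalerA (igen_end K ic cn) scaler0 (igen_id K ic cn) => /(_ erefl).
move=> /ffunP; have il : (i <= Ordinal lin < (b' i).+1)%N by rewrite /= leqnn.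
by move=> /(_ (Sub (Ordinal lin) il)) /eqP; rewrite !ffunE /= eqxx oner_eq0.
Qed.

Definition torsion_word (tp : torsion_pair K Q) : seq nat :=
  bracket_word (s2val (cid2 (torsion_pair_bracket tp))) n.

(** The class determines the vector below [n], so the arbitrary choice in [torsion_word] does not
    matter. *)
Lemma torsion_wordP tp b : bracket_vector n b ->
  torsion_free tp = bracket_free b -> torsion_word tp = bracket_word b n.
Proof.
move=> vb Fb; rewrite /torsion_word; case: cid2 => b' /= vb' Fb'.
apply: eq_bracket_word => i lin; apply/eqP; rewrite eqn_leq.
by rewrite !(@bracket_free_le b b', @bracket_free_le b' b) // -?Fb.
Qed.

Lemma torsion_word_inj : injective torsion_word.
Proof.
move=> tp tp'; have [b vb Fb] := torsion_pair_bracket tp.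
have [b' vb' Fb'] := torsion_pair_bracket tp'.
rewrite (torsion_wordP vb Fb) (torsion_wordP vb' Fb') => /bracket_word_inj e.
apply: torsion_pair_eq; rewrite Fb Fb'; apply: funext => X; apply: propext.
by split=> H i x lin; [rewrite -e | rewrite e] => //; apply: H.
Qed.

Lemma mem_torsion_words w :
  w \in bracket_words n <-> exists tp, torsion_word tp = w.
Proof.
split=> [/mem_bracket_words[b vb <-]|[tp <-]]; last first.
  have [b vb Fb] := torsion_pair_bracket tp.
  by apply/mem_bracket_words; exists b; rewrite -?(torsion_wordP vb Fb).
have [|tp Fb] := @bracket_free_torsion_pair b; last first.
  by exists tp; apply: torsion_wordP.
by case: vb => vb _ i /vb/andP[].
Qed.

End LinearTorsion.

Theorem theorem4p4 (K : fieldType) (n : nat) (hn : (1 <= n)%N) :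
  exists f : torsion_pair K (A_quiver n) ->
             complete_strong1_part_partition (A_quiver n),
    bijective f.
Proof.
apply: (@bijective_of_enum _ _ _ (@torsion_word K n) (@csp_word n)
  (bracket_words n) (level_words n)).
- exact: uniq_bracket_words.
- exact: uniq_level_words.
- exact/esym/size_level_bracket.
- exact: torsion_word_inj.
- exact: mem_torsion_words.
- exact: csp_word_inj.
- exact: mem_level_words.
Qed.
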